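(* Fix $\varepsilon>0$ and $\sigma\in\mathbb R$, and for $n\in\mathbb N$ (large enough that $t>0$) set $$t=n-2^{-1/3}\sigma n^{1/3}.$$ Let $a_0,\ldots,a_{n-2}\in(0,1)$ be the unique solution in $(0,1)^{n-1}$ of $$a_{k+1}+a_{k-1}=\frac{k+\varepsilon}{t}\,\frac{2a_k}{1-a_k^2},\qquad k=0,\ldots,n-2,$$ with boundary conditions $a_{-1}=a_{n-1}=1$ (the $a_k$ depend on $n$). Then, for every $x<0$, $$\lim_{n\to\infty,\ k/n^{1/3}\to x} n^{1/3}a_{n+k}=2^{1/3}\,y_{b(\sigma)}\left(2^{1/3}x+\sigma\right),$$ where the limit is along integers $k=k_n$ with $k_n/n^{1/3}\to x$ as $n\to\infty$, and $y_{b(\sigma)}$ is the solution of the Painlevé II equation $y''=xy+2y^3$ with $y(x)=\sqrt{-x/2}\,(1+o(1))$ as $x\to-\infty$ having its first (left-most) real pole at $\sigma$, i.e. $b(\sigma)$ is the unique $b>0$ for which the first real pole of $y_b$ is at $\sigma$.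
   Context: For all $t,\varepsilon>0$ and $n\in\mathbb N$ the boundary value problem has a unique solution in $(0,1)^{n-1}$. The Hastings–McLeod solution $y_0$ of $y''=xy+2y^3$ is the real solution, real analytic on all of $\mathbb R$, with $y_0(x)=\sqrt{-x/2}\,(1+o(1))$ as $x\to-\infty$ and $y_0(x)=\mathrm{Ai}(x)(1+o(1))$ as $x\to+\infty$. For $b\in\mathbb R$, $y_b$ denotes the (real, meromorphic) solution of $y''=xy+2y^3$ characterized by $$y_b(x)=y_0(x)+\frac{b}{(-x)^{1/4}}\exp\left(-\frac{2\sqrt2}{3}(-x)^{3/2}\right)(1+o(1)),\qquad x\to-\infty .$$ $\sigma(b)$ denotes the first (left-most) pole of $y_b$ on $\mathbb R$. The map $b\mapsto\sigma(b)$ is a strictly decreasing bijection from $(0,\infty)$ to $\mathbb R$ (and for $b>0$ this pole is simple with residue $-1$); $\sigma\mapsto b(\sigma)$ denotes its inverse. *)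

(* Defs.v *)
From Stdlib Require Import Reals ZArith.
From Coquelicot Require Import Coquelicot.

Open Scope R_scope.

(** ** Asymptotics, analytic functions and poles on the real line *)

(** [f = g (1 + o(1))] along the filter [F]. *)
Definition eq_one_plus_o (F : (R -> Prop) -> Prop) (f g : R -> R) : Prop :=
  exists e : R -> R,
    filterlim e F (locally 0) /\ F (fun x => f x = g x * (1 + e x)).

Definition analytic_at (f : R -> R) (x0 : R) : Prop :=
  exists c : nat -> R, locally x0 (fun x => is_pseries c (x - x0) (f x)).

(** The value [f x0] at a pole is irrelevant, hence the punctured
    neighbourhood filter [locally']. *)
Definition is_pole (f : R -> R) (x0 : R) : Prop :=
  exists (m : nat) (g : R -> R),
    (1 <= m)%nat /\ analytic_at g x0 /\ g x0 <> 0 /\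
    locally' x0 (fun x => f x = g x / (x - x0) ^ m).

Definition meromorphic (f : R -> R) : Prop :=
  forall x0 : R, analytic_at f x0 \/ is_pole f x0.

Definition is_first_pole (f : R -> R) (s : R) : Prop :=
  is_pole f s /\ forall x : R, x < s -> ~ is_pole f x.

(** ** Painlevé II *)

(** Every solution of [y'' = x y + 2 y^3] extends meromorphically to the
    complex plane (Painlevé property), so requiring meromorphy along the real
    axis only describes the same class of real solutions. *)
Definition PII_solution (y : R -> R) : Prop :=
  meromorphic y /\
  forall x : R, ~ is_pole y x -> is_derive_n y 2 x (x * y x + 2 * y x ^ 3).

(** The improper integral converges conditionally for every real [x]. *)
Definition Ai (x : R) : R :=
  / PI * RInt_gen (fun s : R => cos (s ^ 3 / 3 + x * s))
           (at_point 0) (Rbar_locally p_infty).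

Definition is_Hastings_McLeod (y0 : R -> R) : Prop :=
  PII_solution y0 /\
  (forall x : R, analytic_at y0 x) /\
  eq_one_plus_o (Rbar_locally m_infty) y0 (fun x => sqrt (- x / 2)) /\
  eq_one_plus_o (Rbar_locally p_infty) y0 Ai.

(** [y] is the solution [y_b], where [y0] is the Hastings–McLeod solution.
    For [b = 0] the condition says that [y = y0] near minus infinity. *)
Definition is_PII_family (y0 : R -> R) (b : R) (y : R -> R) : Prop :=
  PII_solution y /\
  eq_one_plus_o (Rbar_locally m_infty)
    (fun x => y x - y0 x)
    (fun x => b / Rpower (- x) (1 / 4)
              * exp (- (2 * sqrt 2 / 3) * Rpower (- x) (3 / 2))).

(** ** The discrete boundary value problem *)

Definition tpar (sigma : R) (n : nat) : R :=
  INR n - Rpower 2 (- (1 / 3)) * sigma * Rpower (INR n) (1 / 3).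

(** Only the values [a k] with [-1 <= k <= n - 1] are constrained. *)
Definition is_bvp_solution (eps t : R) (n : nat) (a : Z -> R) : Prop :=
  (forall k : Z, (0 <= k <= Z.of_nat n - 2)%Z -> 0 < a k < 1) /\
  a (-1)%Z = 1 /\
  a (Z.of_nat n - 1)%Z = 1 /\
  (forall k : Z, (0 <= k <= Z.of_nat n - 2)%Z ->
     a (k + 1)%Z + a (k - 1)%Z
     = (IZR k + eps) / t * (2 * a k / (1 - a k ^ 2))).

(* Main.v *)
(** Write [h = n^(-1/3)], [s = 2^(-1/3) sigma] and
    [u z = 2^(1/3) y (2^(1/3) z + sigma)], so that [u'' = 2 (z + s) u + 2 u^3] on
    the negative half-line.

    Since [2 / (1 - a^2)] increases with [a], positive sub- and supersolutions of
    the recurrence are ordered as soon as they are ordered at the two ends of an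
    interval of indices: look at the maximum of their quotient.  The functions
    [(1 - de) h u (h (k - n))] and [(1 + de) h u (h (k - n))] are a sub- and a
    supersolution on [-L <= h (k - n) <= -eta] for [n] large, because the factor
    changes the cubic term by an amount that dominates the discretisation error.
    At the end [-eta] both [a_k / h] and [u] are close to [1 / eta], at the end
    [-L] both are close to [sqrt L]: for [a_k] this follows from explicit barriers,
    for [u] from the simple pole of [y] and from its behaviour at [-oo].

    It remains to see that [y > 0] to the left of its pole.  The Hastings-McLeod
    solution [y0] is positive: an energy argument shows that a solution behaving
    like [sqrt (-x/2)] at [-oo] decreases forever after its first zero, while
    [y0] tends to [0] at [+oo] like [Ai].  Then [y > y0], since [y / y0] cannot
    have an interior maximum where it exceeds [1]. *)

Require Import Defs.
From Stdlib Require Import Reals ZArith Lra Lia.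
From Coquelicot Require Import Coquelicot.

Open Scope R_scope.

(** * The recurrence: comparison principle and barriers *)

(** Errors are measured relatively. With [a = h u] the coefficient [(k + eps) / t] is
    [1 + h^2 (x + s) + O(h^3)], and a factor [1 + de] or [1 - de] cancels from everything linear in
    [u]. The cubic term keeps the square of the factor: after division by [h] this is a gain of
    order [de h^2 u^3], whereas on a compact interval of [x] all other errors are [o(h^2)]. The
    obstacle is the two ends, where compactness is lost: the profile blows up at [0] and is
    unbounded at [-oo]. There the barriers need only the right leading term, because [eta] and [L]
    are chosen after [de]: [1 / X] beats every bounded correction as [X] tends to [0], and [sqrt X]
    at infinity does not feel a bounded shift of [X]. Hence the crude constants in the barriers. The
    same quotient argument, with derivatives in place of differences, orders solutions of the
    differential equation: linear terms cancel in [y'' v - y v''] and the cubic one decides the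
    sign. *)

Lemma Z_argmax (f : Z -> R) (p q : Z) : (p <= q)%Z ->
  exists m : Z, (p <= m <= q)%Z /\ forall k : Z, (p <= k <= q)%Z -> f k <= f m.
Proof.
intros Hpq.
replace q with (p + Z.of_nat (Z.to_nat (q - p)))%Z by lia.
induction (Z.to_nat (q - p)) as [|d [m [Hm Hmax]]].
- exists p; split; [lia|].
  intros k Hk; replace k with p by lia; lra.
- destruct (Rle_lt_dec (f (p + Z.of_nat (S d))%Z) (f m)) as [H|H].
  + exists m; split; [lia|]. intros k Hk.
    destruct (Z.eq_dec k (p + Z.of_nat (S d))) as [->|Hne]; [exact H|].
    apply Hmax; lia.
  + exists (p + Z.of_nat (S d))%Z; split; [lia|]. intros k Hk.
    destruct (Z.eq_dec k (p + Z.of_nat (S d))) as [->|Hne]; [lra|].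
    apply Rle_trans with (f m); [apply Hmax; lia|lra].
Qed.

(* At an interior maximum of [A / B] with value [> 1] the two inequalities
   would force [2 / (1 - A^2) <= 2 / (1 - B^2)]. *)
Lemma discrete_comparison (c A B : Z -> R) (p q : Z) :
  (forall k, (p <= k <= q)%Z -> 0 < B k) ->
  A p <= B p -> A q <= B q ->
  (forall k, (p < k < q)%Z -> 0 < c k) ->
  (forall k, (p < k < q)%Z -> B k < A k ->
     A k < 1 /\ c k * (2 * A k / (1 - A k ^ 2)) <= A (k + 1)%Z + A (k - 1)%Z) ->
  (forall k, (p < k < q)%Z -> B k < A k ->
     B (k + 1)%Z + B (k - 1)%Z <= c k * (2 * B k / (1 - B k ^ 2))) ->
  forall k, (p <= k <= q)%Z -> A k <= B k.
Proof.
intros HB Hp Hq Hc HsubA HsupB k Hk.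
apply Rnot_lt_le; intros Hlt.
destruct (Z_argmax (fun k => A k / B k) p q) as [m [Hm Hmax]]; [lia|].
cbv beta in Hmax.
assert (HBm := HB m Hm).
assert (Hr1 : 1 < A m / B m).
{ apply Rlt_le_trans with (A k / B k); [|now apply Hmax].
  apply Rmult_lt_reg_r with (B k); [now apply HB|].
  field_simplify; [lra|]. specialize (HB k Hk); lra. }
set (r := A m / B m) in *.
assert (HAm : A m = r * B m) by (unfold r; field; lra).
assert (Hgt : B m < A m) by (rewrite HAm; nra).
assert (Hint : (p < m < q)%Z).
{ assert (m <> p) by (intros ->; lra). assert (m <> q) by (intros ->; lra). lia. }
assert (Hle : forall j, (p <= j <= q)%Z -> A j <= r * B j).
{ intros j Hj. assert (HBj := HB j Hj). apply Rmult_le_reg_r with (/ B j).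
  - now apply Rinv_0_lt_compat.
  - replace (r * B j * / B j) with r by (field; lra). now apply Hmax. }
destruct (HsubA m Hint Hgt) as [HA1 HA].
specialize (HsupB m Hint Hgt). specialize (Hc m Hint).
assert (H1 := Hle (m + 1)%Z ltac:(lia)).
assert (H2 := Hle (m - 1)%Z ltac:(lia)).
assert (HE : c m * (2 * A m / (1 - A m ^ 2)) <= c m * (2 * A m / (1 - B m ^ 2))).
{ replace (c m * (2 * A m / (1 - B m ^ 2)))
    with (r * (c m * (2 * B m / (1 - B m ^ 2)))).
  - apply Rle_trans with (r * (B (m + 1)%Z + B (m - 1)%Z)); [lra|].
    apply Rmult_le_compat_l; lra.
  - rewrite HAm. field. nra. }
apply Rmult_le_reg_l in HE; [|exact Hc].
unfold Rdiv in HE. apply Rmult_le_reg_l in HE; [|lra].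
apply (Rlt_irrefl (/ (1 - A m ^ 2))).
apply Rle_lt_trans with (1 := HE).
apply Rinv_lt_contravar; [apply Rmult_lt_0_compat|]; nra.
Qed.

Lemma bvp_solution_pos (eps t : R) (n : nat) (a : Z -> R) (k : Z) :
  is_bvp_solution eps t n a -> (-1 <= k <= Z.of_nat n - 1)%Z -> 0 < a k <= 1.
Proof.
intros [H1 [H2 [H3 _]]] Hk.
destruct (Z.eq_dec k (-1)) as [->|]; [lra|].
destruct (Z.eq_dec k (Z.of_nat n - 1)) as [->|]; [lra|].
specialize (H1 k ltac:(lia)); lra.
Qed.

(** Concavity gives the square root a nonpositive second difference; this is what makes it a
    supersolution in the upper barrier. *)
Lemma sqrt_midpoint_concave (u d : R) : 0 <= u - d -> 0 <= d ->
  sqrt (u + d) + sqrt (u - d) <= 2 * sqrt u.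
Proof.
intros H1 H2.
assert (Ha := sqrt_sqrt (u + d) ltac:(lra)). assert (Hb := sqrt_sqrt (u - d) H1).
assert (Hc := sqrt_sqrt u ltac:(lra)).
assert (P1 := sqrt_pos (u + d)). assert (P2 := sqrt_pos (u - d)).
assert (P3 := sqrt_pos u).
apply Rsqr_incr_0_var; [unfold Rsqr|lra].
assert (0 <= (sqrt (u + d) - sqrt (u - d)) ^ 2) by apply pow2_ge_0.
nra.
Qed.

(* [1 / (n - k)] solves the recurrence exactly when [(k + eps) / t] is replaced
   by [1]; the square root is the equilibrium [a^2 = 1 - (k + eps) / t], up to
   the shift [m]. *)
Lemma bvp_upper_barrier (eps t m : R) (n : nat) (a : Z -> R) (k : Z) :
  0 < eps -> 0 < t -> 0 <= m -> t <= INR n + m ->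
  is_bvp_solution eps t n a -> (-1 <= k <= Z.of_nat n - 1)%Z ->
  a k <= / (INR n - IZR k) + sqrt ((INR n - IZR k + m) / t).
Proof.
intros Heps Ht Hm Htn Ha Hk.
assert (Hjge : forall j : Z, (j <= Z.of_nat n - 1)%Z -> 1 <= INR n - IZR j).
{ intros j Hj. rewrite INR_IZR_INZ, <- minus_IZR. apply IZR_le; lia. }
assert (Hpos := fun j => bvp_solution_pos eps t n a j Ha).
destruct Ha as [H01 [Hl [Hr Hrec]]].
revert k Hk.
apply (discrete_comparison (fun k => (IZR k + eps) / t)).
- intros k Hk. assert (H := Hjge k ltac:(lia)).
  assert (0 < / (INR n - IZR k)) by (apply Rinv_0_lt_compat; lra).
  assert (H' := sqrt_pos ((INR n - IZR k + m) / t)). lra.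
- rewrite Hl. assert (H := Hjge (-1)%Z ltac:(lia)).
  assert (0 < / (INR n - -1)) by (apply Rinv_0_lt_compat; lra).
  (* Here [t <= INR n + m] lifts the square root above [a (-1) = 1]. At the right end the term
     [1 / (n - k)] alone equals [1]. *)
  assert (1 <= sqrt ((INR n - -1 + m) / t)); [|lra].
  rewrite <- sqrt_1 at 1. apply sqrt_le_1_alt.
  apply Rmult_le_reg_r with t; [lra|]. field_simplify; lra.
- rewrite Hr. rewrite minus_IZR, <- INR_IZR_INZ.
  replace (INR n - (INR n - 1)) with 1 by ring. rewrite Rinv_1.
  assert (H' := sqrt_pos ((1 + m) / t)). lra.
- intros k Hk. apply Rdiv_lt_0_compat; [|lra].
  assert (0 <= IZR k) by (apply IZR_le; lia). lra.
- intros k Hk _. split; [apply H01; lia|]. rewrite Hrec by lia. lra.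
- intros k Hk HBA. assert (Hk1 := proj2 (H01 k ltac:(lia))).
  assert (Hj := Hjge (k + 1)%Z ltac:(lia)).
  rewrite minus_IZR, plus_IZR in *.
  set (j := INR n - IZR k) in *.
  replace (INR n - (IZR k + 1)) with (j - 1) in * by (unfold j; ring).
  replace (INR n - (IZR k - 1)) with (j + 1) in * by (unfold j; ring).
  assert (Hconc : sqrt ((j - 1 + m) / t) + sqrt ((j + 1 + m) / t)
                  <= 2 * sqrt ((j + m) / t)).
  { rewrite Rplus_comm.
    replace ((j + 1 + m) / t) with ((j + m) / t + / t) by (field; lra).
    replace ((j - 1 + m) / t) with ((j + m) / t - / t) by (field; lra).
    apply sqrt_midpoint_concave.
    - replace ((j + m) / t - / t) with ((j - 1 + m) / t) by (field; lra).
      apply Rdiv_le_0_compat; lra.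
    - left; now apply Rinv_0_lt_compat. }
  set (q := sqrt ((j + m) / t)) in *.
  assert (Hq0 : 0 <= q) by apply sqrt_pos.
  assert (Hqq : q * q = (j + m) / t)
    by (apply sqrt_sqrt; apply Rdiv_le_0_compat; lra).
  (* The shift [m] compensates the possible excess of [t] over [n], so [1 - q^2] stays below the
     true coefficient. *)
  assert (Hc : 1 - q * q <= (IZR k + eps) / t).
  { rewrite Hqq. apply Rmult_le_reg_r with t; [lra|].
    field_simplify; unfold j in *; lra. }
  set (c := (IZR k + eps) / t) in *.
  assert (Hpp : / (j - 1) + / (j + 1) = 2 * / j / (1 - (/ j) ^ 2)) by (field; nra).
  assert (Hp0 : 0 < / j) by (apply Rinv_0_lt_compat; lra).
  set (p := / j) in *.
  (* The comparison asks for the supersolution inequality only where the barrier lies below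
     [a k < 1]; this keeps [1 - (p + q)^2] positive. *)
  assert (Hs1 : p + q < 1) by lra.
  apply Rle_trans with (2 * (p / (1 - p ^ 2)) + 2 * q).
  { replace (2 * (p / (1 - p ^ 2))) with (2 * p / (1 - p ^ 2)) by (field; nra).
    lra. }
  apply Rle_trans with ((1 - q * q) * (2 * (p + q) / (1 - (p + q) ^ 2))).
  (* Both sides are now [2 (p + q)] plus twice a remainder, and the remainders compare factor by
     factor. *)
  + replace (p / (1 - p ^ 2)) with (p + p * p ^ 2 / (1 - p ^ 2)) by (field; nra).
    replace ((1 - q * q) * (2 * (p + q) / (1 - (p + q) ^ 2)))
      with (2 * (p + q) + 2 * ((p + q) * (p ^ 2 + 2 * p * q) / (1 - (p + q) ^ 2)))
      by (field; nra).
    assert (p * p ^ 2 / (1 - p ^ 2)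
            <= (p + q) * (p ^ 2 + 2 * p * q) / (1 - (p + q) ^ 2)); [|lra].
    unfold Rdiv. apply Rmult_le_compat.
    * nra.
    * left; apply Rinv_0_lt_compat; nra.
    * apply Rmult_le_compat; nra.
    * apply Rinv_le_contravar; nra.
  + apply Rmult_le_compat_r; [|exact Hc].
    apply Rdiv_le_0_compat; nra.
Qed.

Lemma sinh_pos (x : R) : 0 < x -> 0 < sinh x.
Proof. intros H. unfold sinh. assert (exp (- x) < exp x) by (apply exp_increasing; lra). lra. Qed.

Lemma cosh_ge_1 (x : R) : 1 <= cosh x.
Proof.
unfold cosh. rewrite exp_Ropp.
assert (H := exp_pos x). set (e := exp x) in *.
apply Rmult_le_reg_r with (2 * e); [lra|]. field_simplify; [|lra].
assert (H' := pow2_ge_0 (e - 1)). nra.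
Qed.

Lemma sinh_ge_id (x : R) : 0 < x -> x <= sinh x.
Proof.
intros Hx.
destruct (MVT_cor2 sinh cosh 0 x Hx) as [c [H _]].
{ intros c _. apply derivable_pt_lim_sinh. }
rewrite sinh_0 in H. assert (Hc := cosh_ge_1 c). nra.
Qed.

Lemma sinh_plus (x y : R) : sinh (x + y) = sinh x * cosh y + cosh x * sinh y.
Proof.
unfold sinh, cosh. rewrite Ropp_plus_distr, !exp_plus. field.
Qed.

Lemma sinh_minus (x y : R) : sinh (x - y) = sinh x * cosh y - cosh x * sinh y.
Proof.
unfold sinh, cosh. replace (- (x - y)) with (- x + y) by ring.
replace (x - y) with (x + - y) by ring. rewrite !exp_plus. field.
Qed.

Lemma cosh2_sinh2 (x : R) : cosh x * cosh x = 1 + sinh x * sinh x.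
Proof.
unfold sinh, cosh. rewrite exp_Ropp. assert (H := exp_pos x). field. lra.
Qed.

Lemma cosh_ge_quadratic (x : R) : 0 < x -> 1 + x ^ 2 / 2 <= cosh x.
Proof.
intros Hx.
assert (H : cosh x = 1 + 2 * (sinh (x / 2) * sinh (x / 2))).
{ assert (E1 := exp_pos (x / 2)). unfold cosh, sinh.
  replace x with (x / 2 + x / 2) at 1 2 by field.
  replace (- (x / 2 + x / 2)) with (- (x / 2) + - (x / 2)) by ring.
  rewrite !exp_plus, !exp_Ropp. field. lra. }
rewrite H. assert (H' := sinh_ge_id (x / 2) ltac:(lra)). nra.
Qed.

(* The discrete counterpart of [m / sinh (m X)], the solution of
   [v'' = m^2 v + 2 v^3]: it solves the recurrence exactly when [(k + eps) / t]
   is replaced by [cosh b]. *)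
Lemma bvp_lower_barrier (eps t b : R) (n : nat) (a : Z -> R) (k : Z) :
  0 < eps -> 0 < t -> 0 < b -> INR n + eps <= t * cosh b ->
  is_bvp_solution eps t n a -> (-1 <= k <= Z.of_nat n - 1)%Z ->
  sinh b / sinh (b * (INR n - IZR k)) <= a k.
Proof.
intros Heps Ht Hb Htn Ha Hk.
assert (Hjge : forall j : Z, (j <= Z.of_nat n - 1)%Z -> 1 <= INR n - IZR j).
{ intros j Hj. rewrite INR_IZR_INZ, <- minus_IZR. apply IZR_le; lia. }
assert (Hpos := fun j => bvp_solution_pos eps t n a j Ha).
destruct Ha as [H01 [Hl [Hr Hrec]]].
assert (Hb0 := sinh_pos b Hb).
revert k Hk.
apply (discrete_comparison (fun k => (IZR k + eps) / t)).
- intros k Hk. apply Hpos; lia.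
- rewrite Hl. assert (H := Hjge (-1)%Z ltac:(lia)).
  assert (0 <= INR n) by apply pos_INR.
  assert (sinh b < sinh (b * (INR n - -1)) \/ sinh b = sinh (b * (INR n - -1))).
  { destruct (Req_dec (INR n) 0) as [E|E].
    - right. rewrite E. f_equal. ring.
    - left. apply sinh_lt. nra. }
  apply Rmult_le_reg_r with (sinh (b * (INR n - -1))); [lra|].
  unfold Rdiv. rewrite Rmult_assoc, Rinv_l; lra.
- rewrite Hr. rewrite minus_IZR, <- INR_IZR_INZ.
  replace (b * (INR n - (INR n - 1))) with b by ring.
  right. field. lra.
- intros k Hk. apply Rdiv_lt_0_compat; [|lra].
  assert (0 <= IZR k) by (apply IZR_le; lia). lra.
- intros k Hk _.
  assert (Hj := Hjge (k + 1)%Z ltac:(lia)).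
  rewrite minus_IZR, plus_IZR in *.
  set (j := INR n - IZR k) in *.
  replace (INR n - (IZR k + 1)) with (j - 1) in * by (unfold j; ring).
  replace (INR n - (IZR k - 1)) with (j + 1) in * by (unfold j; ring).
  assert (Hbj : b < b * j) by nra.
  assert (HS := sinh_lt _ _ Hbj).
  assert (Hm := sinh_pos (b * (j - 1)) ltac:(nra)).
  assert (Hp := sinh_pos (b * (j + 1)) ltac:(nra)).
  replace (b * (j - 1)) with (b * j - b) in * by ring.
  replace (b * (j + 1)) with (b * j + b) in * by ring.
  rewrite sinh_minus in *. rewrite sinh_plus in *.
  assert (Cb := cosh2_sinh2 b). assert (Cj := cosh2_sinh2 (b * j)).
  set (S := sinh (b * j)) in *. set (C := cosh (b * j)) in *.
  set (sb := sinh b) in *.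
  split.
  { apply Rmult_lt_reg_r with S; [lra|]. unfold Rdiv.
    rewrite Rmult_assoc, Rinv_l; lra. }
  assert (Hsum : sb / (S * cosh b - C * sb) + sb / (S * cosh b + C * sb)
    = cosh b * (2 * (sb / S) / (1 - (sb / S) ^ 2))).
  (* The product formula [sinh (y - b) sinh (y + b) = sinh^2 y - sinh^2 b], with [y = b j], makes
     the barrier an exact solution with coefficient [cosh b]. *)
  { assert (Hd : (S * cosh b - C * sb) * (S * cosh b + C * sb) = S ^ 2 - sb ^ 2).
    { replace ((S * cosh b - C * sb) * (S * cosh b + C * sb))
        with (S * S * (cosh b * cosh b) - (C * C) * (sb * sb)) by ring.
      rewrite Cb, Cj. ring. }
    replace (sb / (S * cosh b - C * sb) + sb / (S * cosh b + C * sb))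
      with (2 * sb * S * cosh b / ((S * cosh b - C * sb) * (S * cosh b + C * sb)))
      by (field; lra).
    rewrite Hd. field. split; [lra|]. nra. }
  rewrite Rplus_comm. replace (sb / (S * cosh b + C * sb) + sb / (S * cosh b - C * sb))
    with (sb / (S * cosh b - C * sb) + sb / (S * cosh b + C * sb)) by ring.
  rewrite Hsum. apply Rmult_le_compat_r.
  + assert (0 < sb / S < 1).
    { split; [apply Rdiv_lt_0_compat; lra|].
      apply Rmult_lt_reg_r with S; [lra|]. unfold Rdiv.
      rewrite Rmult_assoc, Rinv_l; lra. }
    apply Rdiv_le_0_compat; nra.
  + apply Rmult_le_reg_r with t; [lra|].
    unfold Rdiv. rewrite Rmult_assoc, Rinv_l by lra. unfold j in *. lra.
- intros k Hk _. rewrite Hrec by lia. lra.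
Qed.

Lemma cos_ge_quadratic (w : R) : 0 < w -> 1 - w ^ 2 / 2 <= cos w.
Proof.
intros Hw. replace w with (2 * (w / 2)) at 2 by field.
rewrite cos_2a_sin.
assert (H : sin (w / 2) < w / 2) by (apply sin_lt_x; lra).
assert (H' : - (w / 2) <= sin (w / 2)).
{ destruct (Rle_lt_dec (w / 2) 1) as [H1|H1].
  - assert (0 <= sin (w / 2)); [|lra]. apply sin_ge_0; [lra|].
    assert (h := PI2_1). lra.
  - assert (h := SIN_bound (w / 2)). lra. }
assert (0 <= (w / 2 - sin (w / 2)) * (w / 2 + sin (w / 2))); [|nra].
apply Rmult_le_pos; lra.
Qed.

(** An interior estimate: the arch [A cos (w (k - k0))] is nonpositive at [k0 - l] and [k0 + l],
    where positivity of [a] is enough. Since neighbouring cosines add up to [2 cos w] times the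
    middle one, the arch is a subsolution as soon as the coefficient is at most [cos w (1 - A^2)].
    The coefficient increases with [k], so it is tested at [k0 + l]. *)
Lemma bvp_bump (eps t A w : R) (n : nat) (a : Z -> R) (k0 l : Z) :
  0 < eps -> 0 < t -> 0 < A < 1 -> 0 < w -> w ^ 2 < 2 ->
  (0 < l)%Z -> PI / 2 <= w * IZR l <= 3 * (PI / 2) ->
  (-1 <= k0 - l)%Z -> (k0 + l <= Z.of_nat n - 1)%Z ->
  (IZR k0 + IZR l + eps) / t <= (1 - w ^ 2 / 2) * (1 - A ^ 2) ->
  is_bvp_solution eps t n a ->
  A <= a k0.
Proof.
intros Heps Ht HA Hw Hw2 Hl Hwl Hk1 Hk2 Hc Ha.
assert (Hpos := fun j => bvp_solution_pos eps t n a j Ha).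
destruct Ha as [H01 [_ [_ Hrec]]].
replace A with (A * cos (w * (IZR k0 - IZR k0))) by
  (replace (w * (IZR k0 - IZR k0)) with 0 by ring; rewrite cos_0; ring).
apply (discrete_comparison (fun k => (IZR k + eps) / t)
  (fun k => A * cos (w * (IZR k - IZR k0))) a (k0 - l) (k0 + l)).
- intros k Hk. apply Hpos; lia.
- apply Rle_trans with 0; [|left; apply Hpos; lia].
  rewrite minus_IZR.
  replace (w * (IZR k0 - IZR l - IZR k0)) with (- (w * IZR l)) by ring.
  rewrite cos_neg. assert (H := cos_le_0 _ (proj1 Hwl) (proj2 Hwl)). nra.
- apply Rle_trans with 0; [|left; apply Hpos; lia].
  rewrite plus_IZR.
  replace (w * (IZR k0 + IZR l - IZR k0)) with (w * IZR l) by ring.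
  assert (H := cos_le_0 _ (proj1 Hwl) (proj2 Hwl)). nra.
- intros k Hk. apply Rdiv_lt_0_compat; [|lra].
  assert (0 <= IZR k) by (apply IZR_le; lia). lra.
- intros k Hk Hlt.
  assert (Hak := Hpos k ltac:(lia)).
  rewrite minus_IZR, plus_IZR.
  replace (w * (IZR k + 1 - IZR k0)) with (w * (IZR k - IZR k0) + w) by ring.
  replace (w * (IZR k - 1 - IZR k0)) with (w * (IZR k - IZR k0) - w) by ring.
  rewrite cos_plus, cos_minus.
  assert (Hb := COS_bound (w * (IZR k - IZR k0))).
  set (C := cos (w * (IZR k - IZR k0))) in *.
  (* Only indices where the arch exceeds the positive [a k] matter, so the cosine is positive
     there. *)
  assert (HC : 0 < C) by nra.
  assert (HB : 0 < A * C <= A) by (split; nra).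
  split; [lra|].
  assert (Hcos := cos_ge_quadratic w Hw).
  assert (Hck : (IZR k + eps) / t <= cos w * (1 - (A * C) ^ 2)).
  { apply Rle_trans with ((1 - w ^ 2 / 2) * (1 - A ^ 2)).
    - apply Rle_trans with (2 := Hc). unfold Rdiv. apply Rmult_le_compat_r.
      + left; now apply Rinv_0_lt_compat.
      + assert (IZR k <= IZR k0 + IZR l); [|lra].
        rewrite <- plus_IZR; apply IZR_le; lia.
    - apply Rmult_le_compat; nra. }
  apply Rle_trans with (cos w * (1 - (A * C) ^ 2) * (2 * (A * C) / (1 - (A * C) ^ 2))).
  + apply Rmult_le_compat_r; [|exact Hck]. apply Rdiv_le_0_compat; nra.
  + right. field. nra.
- intros k Hk _. rewrite Hrec by lia. lra.
- lia.
Qed.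

(** * Calculus *)

(** Differentiates expressions in functions whose derivatives are known only through [is_derive]
    hypotheses: these settle the existence conditions and replace each [Derive] by its recorded
    value. *)
Ltac derive_known :=
  auto_derive;
  [ repeat split; try (eexists; eassumption)
  | repeat match goal with
    | H : is_derive ?f ?x ?l |- context [Derive (fun t => ?f t) ?x] =>
        rewrite (is_derive_unique (fun t : R => f t) x l H)
    end; try (simpl; ring) ].

Lemma MVT_is_derive (f f1 : R -> R) (a b : R) : a < b ->
  (forall x, a <= x <= b -> is_derive f x (f1 x)) ->
  exists c, f b - f a = f1 c * (b - a) /\ a < c < b.
Proof.
intros Hab H. apply MVT_cor2; [exact Hab|].
intros c Hc. apply is_derive_Reals. now apply H.
Qed.

Lemma is_derive_continuous (f : R -> R) (x l : R) : is_derive f x l -> continuous f x.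
Proof. intros H. apply (ex_derive_continuous f x). now exists l. Qed.

Lemma is_derive_continuity_pt (f : R -> R) (x l : R) :
  is_derive f x l -> continuity_pt f x.
Proof. intros H. apply continuity_pt_filterlim. now apply is_derive_continuous with l. Qed.

Lemma nondecreasing_is_derive (f f1 : R -> R) (a b : R) : a <= b ->
  (forall x, a <= x <= b -> is_derive f x (f1 x)) ->
  (forall x, a < x < b -> 0 <= f1 x) -> f a <= f b.
Proof.
intros [Hab|<-] H H1; [|lra].
destruct (MVT_is_derive f f1 a b Hab H) as [c [E Hc]].
specialize (H1 c Hc). nra.
Qed.

Lemma is_derive_pos_locally (f : R -> R) (x l : R) : is_derive f x l -> 0 < l ->
  exists d : posreal, forall y, (x < y < x + d -> f x < f y) /\ (x - d < y < x -> f y < f x).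
Proof.
intros H Hl. apply is_derive_Reals in H.
destruct (H l Hl) as [d Hd]. exists d. intros y.
assert (E : forall e, e <> 0 -> Rabs e < d -> 0 < (f (x + e) - f x) / e).
{ intros e He1 He2. specialize (Hd e He1 He2). apply Rabs_def2 in Hd. lra. }
split; intros Hy; specialize (E (y - x) ltac:(lra));
  replace (x + (y - x)) with y in E by ring.
- assert (0 < (f y - f x) / (y - x)) by (apply E; apply Rabs_def1; lra).
  assert (0 < (f y - f x) / (y - x) * (y - x)) by (apply Rmult_lt_0_compat; lra).
  replace ((f y - f x) / (y - x) * (y - x)) with (f y - f x) in H1 by (field; lra). lra.
- assert (0 < (f y - f x) / (y - x)) by (apply E; apply Rabs_def1; lra).
  assert (0 < (f y - f x) / (y - x) * (x - y)) by (apply Rmult_lt_0_compat; lra).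
  replace ((f y - f x) / (y - x) * (x - y)) with (- (f y - f x)) in H1 by (field; lra). lra.
Qed.

(** Only the derivative of [f1] at [m] itself enters: if [l] were positive, [f1] would be positive
    just to the right of its zero [m], and the mean value theorem would lift [f] above its
    maximum. *)
Lemma local_max_derivatives (f f1 : R -> R) (a b m l : R) : a < m < b ->
  (forall x, a < x < b -> is_derive f x (f1 x)) ->
  (forall x, a < x < b -> f x <= f m) ->
  is_derive f1 m l -> f1 m = 0 /\ l <= 0.
Proof.
intros Hm Hd Hmax Hl.
assert (H0 : f1 m = 0).
{ destruct (Rtotal_order (f1 m) 0) as [H|[H|H]]; [|exact H|]; exfalso.
  - assert (Hn : is_derive (fun x => - f x) m (- f1 m)) by (assert (Hdm := Hd m Hm); derive_known).
    destruct (is_derive_pos_locally _ _ _ Hn ltac:(lra)) as [d Hd'].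
    assert (Hdp := cond_pos d).
    set (y := m - Rmin (d / 2) ((m - a) / 2)).
    assert (Rmin (d / 2) ((m - a) / 2) <= d / 2) by apply Rmin_l.
    assert (Rmin (d / 2) ((m - a) / 2) <= (m - a) / 2) by apply Rmin_r.
    assert (0 < Rmin (d / 2) ((m - a) / 2)) by (apply Rmin_pos; lra).
    assert (Hy := proj2 (Hd' y) ltac:(unfold y; lra)).
    assert (Hy' := Hmax y ltac:(unfold y; lra)). lra.
  - destruct (is_derive_pos_locally _ _ _ (Hd m Hm) H) as [d Hd'].
    assert (Hdp := cond_pos d).
    set (y := m + Rmin (d / 2) ((b - m) / 2)).
    assert (Rmin (d / 2) ((b - m) / 2) <= d / 2) by apply Rmin_l.
    assert (Rmin (d / 2) ((b - m) / 2) <= (b - m) / 2) by apply Rmin_r.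
    assert (0 < Rmin (d / 2) ((b - m) / 2)) by (apply Rmin_pos; lra).
    assert (Hy := proj1 (Hd' y) ltac:(unfold y; lra)).
    assert (Hy' := Hmax y ltac:(unfold y; lra)). lra. }
split; [exact H0|].
apply Rnot_lt_le; intros Hlpos.
destruct (is_derive_pos_locally _ _ _ Hl Hlpos) as [d Hd'].
assert (Hdp := cond_pos d).
set (y := m + Rmin (d / 2) ((b - m) / 2)).
assert (Rmin (d / 2) ((b - m) / 2) <= d / 2) by apply Rmin_l.
assert (Rmin (d / 2) ((b - m) / 2) <= (b - m) / 2) by apply Rmin_r.
assert (0 < Rmin (d / 2) ((b - m) / 2)) by (apply Rmin_pos; lra).
destruct (MVT_is_derive f f1 m y) as [c [E Hc]].
- unfold y; lra.
- intros x Hx; apply Hd; unfold y in *; lra.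
- assert (Hc' := proj1 (Hd' c) ltac:(unfold y in *; lra)).
  assert (Hy' := Hmax y ltac:(unfold y; lra)).
  assert (0 < y - m) by (unfold y; lra). nra.
Qed.

Lemma first_zero (g : R -> R) (a b : R) : a < b ->
  (forall x, a <= x <= b -> continuous g x) -> 0 < g a -> g b <= 0 ->
  exists c, a < c <= b /\ g c = 0 /\ forall x, a <= x < c -> 0 < g x.
Proof.
intros Hab Hc Ha Hb.
(* The zero is the supremum of the points up to which [g] stays positive. *)
set (E := fun x => a <= x <= b /\ forall y, a <= y <= x -> 0 < g y).
destruct (completeness E) as [c [Hub Hlub]].
{ exists b. intros x [Hx _]; lra. }
{ exists a. split; [lra|]. intros y Hy; now replace y with a by lra. }
assert (Hac : a <= c).
{ apply Hub. split; [lra|]. intros y Hy; now replace y with a by lra. }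
assert (Hcb : c <= b) by (apply Hlub; intros x [Hx _]; lra).
assert (Hpos : forall x, a <= x < c -> 0 < g x).
{ intros x Hx. apply Rnot_le_lt; intros Hle.
  assert (c <= x); [|lra]. apply Hlub. intros z [Hz1 Hz2].
  apply Rnot_lt_le; intros Hlt. specialize (Hz2 x ltac:(lra)). lra. }
assert (Hcont := Hc c (conj Hac Hcb)).
assert (Hle : g c <= 0).
{ apply Rnot_lt_le; intros Hgc.
  assert (Hloc : locally c (fun x => 0 < g x)).
  { apply (Hcont (fun z => 0 < z)). now apply open_gt. }
  destruct Hloc as [d Hd]. assert (Hdp := cond_pos d).
  destruct (Req_dec c b) as [->|Hne]; [lra|].
  assert (E (c + Rmin (d / 2) (b - c))) as HE.
  { assert (Rmin (d / 2) (b - c) <= d / 2) by apply Rmin_l.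
    assert (Rmin (d / 2) (b - c) <= b - c) by apply Rmin_r.
    assert (0 < Rmin (d / 2) (b - c)) by (apply Rmin_pos; lra).
    split; [lra|]. intros y Hy. destruct (Rlt_le_dec y c); [apply Hpos; lra|].
    apply Hd. apply Rabs_def1; unfold minus, plus, opp; simpl; lra. }
  assert (0 < Rmin (d / 2) (b - c)) by (apply Rmin_pos; lra).
  specialize (Hub _ HE). lra. }
assert (Hac' : a < c) by (destruct Hac as [?|<-]; lra).
assert (Hge : 0 <= g c).
{ apply Rnot_lt_le; intros Hgc.
  assert (Hloc : locally c (fun x => g x < 0)).
  { apply (Hcont (fun z => z < 0)). now apply open_lt. }
  destruct Hloc as [d Hd]. assert (Hdp := cond_pos d).
  set (y := c - Rmin (d / 2) (c - a)).
  assert (Rmin (d / 2) (c - a) <= d / 2) by apply Rmin_l.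
  assert (Rmin (d / 2) (c - a) <= c - a) by apply Rmin_r.
  assert (0 < Rmin (d / 2) (c - a)) by (apply Rmin_pos; lra).
  assert (g y < 0).
  { apply Hd. apply Rabs_def1; unfold minus, plus, opp, y; simpl; lra. }
  specialize (Hpos y ltac:(unfold y; lra)). lra. }
exists c. repeat split; [lra|lra|lra|exact Hpos].
Qed.

Lemma is_lim_m_infty_eps (f : R -> R) (l e : R) : is_lim f m_infty l -> 0 < e ->
  exists M, forall x, x < M -> l - e < f x < l + e.
Proof.
intros H He. apply is_lim_spec in H. specialize (H (mkposreal e He)).
destruct H as [M HM]. exists M. intros x Hx. specialize (HM x Hx). simpl in HM.
apply Rabs_def2 in HM. lra.
Qed.

(** The continuous counterpart of [discrete_comparison]. The value at [x0] beats the one at [x1] by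
    hypothesis and those far to the left because the limit is smaller, so the maximum over a long
    interval is interior. Where the first derivative of [u / v] vanishes, the second has the sign of
    [u'' v - u v'']. *)
Lemma ratio_interior_max (u u1 u2 v v1 v2 : R -> R) (l x0 x1 : R) :
  (forall x, x <= x1 -> is_derive u x (u1 x) /\ is_derive u1 x (u2 x)) ->
  (forall x, x <= x1 -> is_derive v x (v1 x) /\ is_derive v1 x (v2 x)) ->
  (forall x, x <= x1 -> 0 < v x) ->
  is_lim (fun x => u x / v x) m_infty l ->
  x0 < x1 -> l < u x0 / v x0 -> u x1 / v x1 < u x0 / v x0 ->
  exists m, m < x1 /\ u x0 / v x0 <= u m / v m /\ u2 m * v m - u m * v2 m <= 0.
Proof.
intros Hu Hv Hpos Hlim H01 Hl H1.
set (f := fun x => u x / v x) in *.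
destruct (is_lim_m_infty_eps f l (f x0 - l) Hlim ltac:(unfold f; lra)) as [M HM].
set (a := Rmin (M - 1) (x0 - 1)).
assert (HaM : a <= M - 1) by apply Rmin_l.
assert (Ha0 : a <= x0 - 1) by apply Rmin_r.
set (f1 := fun x => (u1 x * v x - u x * v1 x) / (v x) ^ 2).
assert (Hf : forall x, x <= x1 -> is_derive f x (f1 x)).
{ intros x Hx. destruct (Hu x Hx) as [Hu1 _], (Hv x Hx) as [Hv1 _].
  assert (Hp := Hpos x Hx). unfold f, f1.
  apply is_derive_div; [exact Hu1|exact Hv1|lra]. }
destruct (continuity_ab_maj f a x1) as [m [Hmax Hm]].
{ lra. }
{ intros c Hc. apply is_derive_continuity_pt with (f1 c). apply Hf; lra. }
assert (Hm0 : f x0 <= f m) by (apply Hmax; lra).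
assert (Hma : a < m).
{ destruct (Rlt_le_dec a m) as [?|Hle]; [assumption|].
  assert (m = a) by lra. subst m. specialize (HM a ltac:(lra)). lra. }
assert (Hm1 : m < x1).
{ destruct (Rlt_le_dec m x1) as [?|Hle]; [assumption|].
  assert (m = x1) by lra. subst m. unfold f in *; lra. }
exists m. split; [exact Hm1|]. split; [exact Hm0|].
destruct (Hu m ltac:(lra)) as [Hum Hum1], (Hv m ltac:(lra)) as [Hvm Hvm1].
assert (Hp := Hpos m ltac:(lra)).
set (w := u1 m * v m - u m * v1 m).
set (w1 := u2 m * v m - u m * v2 m).
assert (Hnum : is_derive (fun x => u1 x * v x - u x * v1 x) m w1).
{ unfold w1. derive_known. }
assert (Hden : is_derive (fun x => v x ^ 2) m (INR 2 * v1 m * v m ^ 1)).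
{ apply is_derive_pow. exact Hvm. }
assert (Hder := is_derive_div _ _ _ _ _ Hnum Hden ltac:(nra)).
destruct (local_max_derivatives f f1 a x1 m _ (conj Hma Hm1)
  (fun x Hx => Hf x ltac:(lra)) (fun x Hx => Hmax x ltac:(lra)) Hder) as [E1 E2].
fold w in E2.
assert (Hw : w = 0).
{ unfold f1 in E1. fold w in E1. unfold Rdiv in E1. apply Rmult_integral in E1.
  destruct E1 as [E1|E1]; [exact E1|]. exfalso.
  assert (0 < / v m ^ 2) by (apply Rinv_0_lt_compat; nra). lra. }
rewrite Hw in E2. apply Rnot_lt_le; intros Hlt.
assert (Hq : 0 < v m ^ 2) by nra.
assert (0 < (w1 * v m ^ 2 - 0 * (INR 2 * v1 m * v m ^ 1)) / (v m ^ 2) ^ 2); [|lra].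
apply Rdiv_lt_0_compat; nra.
Qed.

(** * Real solutions of Painlevé II *)

Definition PII_ode_at (y y1 : R -> R) (x : R) : Prop :=
  is_derive y x (y1 x) /\ is_derive y1 x (x * y x + 2 * y x ^ 3).

(** Above the parabola [(v^2)'' = 2 v'^2 + 2 v^2 (x + 2 v^2)] is positive while [- x] is linear, so
    [v^2 / - x] has no interior maximum above [1/2]. The limit controls the left end and the zero of
    [v] the right end. *)
Lemma PII_below_parabola (v v1 : R -> R) (z : R) : z < 0 ->
  (forall x, x <= z -> PII_ode_at v v1 x) ->
  is_lim (fun x => v x ^ 2 / - x) m_infty (1 / 2) -> v z = 0 ->
  forall x, x <= z -> v x ^ 2 <= - x / 2.
Proof.
intros Hz Hode Hlim Hvz x Hx. apply Rnot_lt_le; intros Hlt.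
destruct Hx as [Hx|Hx]; [|subst x; rewrite Hvz in Hlt; simpl in Hlt; lra].
assert (Hq : 1 / 2 < v x ^ 2 / - x).
{ apply Rmult_lt_reg_r with (- x); [lra|].
  replace (v x ^ 2 / - x * - x) with (v x ^ 2) by (field; lra). lra. }
destruct (ratio_interior_max (fun x => v x ^ 2) (fun x => 2 * v x * v1 x)
  (fun x => 2 * v1 x ^ 2 + 2 * v x * (x * v x + 2 * v x ^ 3))
  (fun x => - x) (fun _ => -1) (fun _ => 0) (1 / 2) x z) as [m [Hm [Hge Hle]]].
- intros w Hw. destruct (Hode w Hw) as [H1 H2]. split; derive_known.
- intros w Hw. split; auto_derive; auto; ring.
- intros w Hw; lra.
- exact Hlim.
- exact Hx.
- exact Hq.
- rewrite Hvz. unfold Rdiv at 1. rewrite pow_i, Rmult_0_l by lia. lra.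
- assert (Hqm : 1 / 2 < v m ^ 2 / - m) by lra.
  assert (Hvm : - m / 2 < v m ^ 2).
  { apply Rmult_lt_compat_r with (r := - m) in Hqm; [|lra].
    replace (v m ^ 2 / - m * - m) with (v m ^ 2) in Hqm by (field; lra). lra. }
  assert (Hv0 : 0 < v m ^ 2) by lra.
  assert (0 < 2 * v1 m ^ 2 + 2 * v m * (m * v m + 2 * v m ^ 3)).
  { replace (2 * v m * (m * v m + 2 * v m ^ 3))
      with (2 * (v m ^ 2 * (m + 2 * v m ^ 2))) by ring.
    assert (0 < v m ^ 2 * (m + 2 * v m ^ 2)) by (apply Rmult_lt_0_compat; lra).
    assert (0 <= v1 m ^ 2) by apply pow2_ge_0. lra. }
  nra.
Qed.

(** Uniqueness by a Gronwall argument run backwards: [(v^2 + v'^2) exp (K x)] is nondecreasing when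
    [K] bounds [1 + x + 2 v^2] in absolute value, and it vanishes at [z]. *)
Lemma PII_zero_simple (v v1 : R -> R) (z d : R) : 0 < d ->
  (forall x, z - d <= x <= z -> PII_ode_at v v1 x) ->
  v z = 0 -> v1 z = 0 -> forall x, z - d <= x <= z -> v x = 0.
Proof.
intros Hd Hode H0 H1 x Hx.
destruct (continuity_ab_maj (fun x => Rabs (1 + x + 2 * v x ^ 2)) (z - d) z)
  as [k [Hk _]]; [lra| |].
{ intros c Hc. destruct (Hode c Hc) as [Hv _].
  apply (continuity_pt_comp (fun x => 1 + x + 2 * v x ^ 2) Rabs);
    [|apply Rcontinuity_abs].
  apply is_derive_continuity_pt with (1 + 2 * (2 * v c * v1 c)). derive_known. }
set (K := Rabs (1 + k + 2 * v k ^ 2)) in *. cbv beta in Hk.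
set (Q := fun x => (v x ^ 2 + v1 x ^ 2) * exp (K * x)).
assert (HQ : Q x <= Q z).
{ apply nondecreasing_is_derive with (fun x =>
    (2 * v x * v1 x * (1 + x + 2 * v x ^ 2) + K * (v x ^ 2 + v1 x ^ 2)) * exp (K * x)).
  - lra.
  - intros w Hw. destruct (Hode w ltac:(lra)) as [Hv Hv1]. unfold Q. derive_known.
  - intros w Hw. apply Rmult_le_pos; [|left; apply exp_pos].
    assert (HK := Hk w ltac:(lra)). apply Rabs_le_between in HK.
    assert (0 <= (v w + v1 w) ^ 2) by apply pow2_ge_0.
    assert (0 <= (v w - v1 w) ^ 2) by apply pow2_ge_0.
    set (c := 1 + w + 2 * v w ^ 2) in *. nra. }
unfold Q in HQ. rewrite H0, H1 in HQ.
assert (He := exp_pos (K * x)).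
assert (0 <= v x ^ 2) by apply pow2_ge_0.
assert (0 <= v1 x ^ 2) by apply pow2_ge_0.
assert (v x ^ 2 = 0) by nra. nra.
Qed.

(* The normalised energy [(v'^2 - x v^2 - v^4) / x^2] is nondecreasing as long as
   [v^2 <= -x/2] and its limit at [-oo] is the height [1/4] of the potential
   barrier, so a solution that has crossed zero passes the second hilltop. *)
Lemma PII_decreasing_after_zero (v v1 : R -> R) (z x : R) :
  (forall x, PII_ode_at v v1 x) ->
  is_lim (fun x => v x ^ 2 / - x) m_infty (1 / 2) ->
  (forall x, x < z -> 0 < v x) -> v z = 0 -> z <= x -> v1 x < 0.
Proof.
intros Hode Hlim Hpos Hvz Hzx.
assert (Hz1 : v1 z < 0).
{ destruct (Rtotal_order (v1 z) 0) as [H|[H|H]]; [exact H| |]; exfalso.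
  - assert (v (z - 1 / 2) = 0).
    { apply (PII_zero_simple v v1 z 1); [lra|intros; apply Hode|assumption..|lra]. }
    specialize (Hpos (z - 1 / 2) ltac:(lra)). lra.
  - destruct (is_derive_pos_locally v z _ (proj1 (Hode z)) H) as [d Hd].
    assert (Hdp := cond_pos d).
    assert (H' := proj2 (Hd (z - d / 2)) ltac:(lra)).
    specialize (Hpos (z - d / 2) ltac:(lra)). lra. }
apply Rnot_le_lt; intros Hx.
destruct (first_zero (fun x => - v1 x) z x) as [c [Hc [Hc0 Hcpos]]].
{ destruct Hzx as [?|Hzx]; [assumption|subst x; lra]. }
{ intros w _. destruct (Hode w) as [_ H2].
  apply is_derive_continuous with (- (w * v w + 2 * v w ^ 3)). derive_known. }
{ lra. }
{ lra. }
assert (Hc1 : v1 c = 0) by lra.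
assert (Hdec : forall p q, z <= p -> p < q -> q <= c -> v q < v p).
{ intros p q H1 H2 H3.
  destruct (MVT_is_derive v v1 p q H2) as [e [E He]].
  { intros; apply Hode. }
  specialize (Hcpos e ltac:(lra)). nra. }
assert (Hvc : v c < 0) by (rewrite <- Hvz; apply Hdec; lra).
(* At the first turning point [v''] cannot be negative, so [v] turns back before the second hilltop
   [v^2 = - c / 2]. *)
assert (Hcc : c + 2 * v c ^ 2 <= 0).
{ apply Rnot_lt_le; intros Hlt.
  assert (Hn : is_derive (fun x => - v1 x) c (- (c * v c + 2 * v c ^ 3)))
    by (destruct (Hode c) as [_ H2]; derive_known).
  destruct (is_derive_pos_locally _ _ _ Hn) as [d Hd]; [simpl; nra|].
  assert (Hdp := cond_pos d).
  assert (Hm1 : Rmin (d / 2) ((c - z) / 2) <= d / 2) by apply Rmin_l.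
  assert (Hm2 : Rmin (d / 2) ((c - z) / 2) <= (c - z) / 2) by apply Rmin_r.
  assert (Hm3 : 0 < Rmin (d / 2) ((c - z) / 2)) by (apply Rmin_pos; lra).
  assert (H' := proj2 (Hd (c - Rmin (d / 2) ((c - z) / 2))) ltac:(lra)).
  specialize (Hcpos (c - Rmin (d / 2) ((c - z) / 2)) ltac:(lra)). lra. }
assert (Hcneg : c < 0) by nra.
(* Left of [z] this is [PII_below_parabola]; between [z] and [c] the solution lies between [v c] and
   [0], and the parabola is higher there than at [c]. *)
assert (Hbelow : forall w, w <= c -> v w ^ 2 <= - w / 2).
{ intros w Hw. destruct (Rle_lt_dec w z).
  - apply (PII_below_parabola v v1 z); [lra|intros; apply Hode|assumption..].
  - assert (v w < v z) by (apply Hdec; lra).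
    assert (v c <= v w).
    { destruct Hw as [Hw| ->]; [|lra]. left; apply Hdec; lra. }
    nra. }
set (G := fun x => (v1 x ^ 2 - x * v x ^ 2 - v x ^ 4) / x ^ 2).
set (G1 := fun x => (2 * v1 x ^ 2 + v x ^ 2 * (- x - 2 * v x ^ 2)) / (- x ^ 3)).
assert (HG : forall w, w <= c -> is_derive G w (G1 w)).
{ intros w Hw. destruct (Hode w) as [H1 H2]. unfold G, G1. derive_known.
  - simpl. nra.
  - simpl. field. lra. }
assert (HG1 : forall w, w <= c -> 2 * v1 w ^ 2 / (- w ^ 3) <= G1 w).
{ intros w Hw. unfold G1. apply Rmult_le_compat_r.
  - left; apply Rinv_0_lt_compat. assert (0 < (- w) ^ 3) by (apply pow_lt; lra). nra.
  - assert (0 <= v w ^ 2 * (- w - 2 * v w ^ 2)); [|lra].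
    apply Rmult_le_pos; [apply pow2_ge_0|]. specialize (Hbelow w Hw). lra. }
assert (HG1nn : forall w, w <= c -> 0 <= G1 w).
{ intros w Hw. apply Rle_trans with (2 := HG1 w Hw). apply Rdiv_le_0_compat.
  - assert (0 <= v1 w ^ 2) by apply pow2_ge_0. lra.
  - assert (0 < (- w) ^ 3) by (apply pow_lt; lra). nra. }
assert (HGz : G z < G c).
{ destruct (MVT_is_derive G G1 z c) as [e [E He]]; [lra|intros; apply HG; lra|].
  assert (0 < G1 e); [|nra].
  apply Rlt_le_trans with (2 := HG1 e ltac:(lra)). apply Rdiv_lt_0_compat.
  - specialize (Hcpos e ltac:(lra)). nra.
  - assert (0 < (- e) ^ 3) by (apply pow_lt; lra). nra. }
(* With [v' = 0] the energy is [r - r^2] for [r = v^2 / - x], which is at most [1/4]. Dropping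
   [v'^2] gives the same expression as a lower bound for [G] near [-oo], where [r] tends to [1/2].
   This contradicts the strict growth of [G] from [z] to [c]. *)
assert (HGc : G c <= 1 / 4).
{ unfold G. rewrite Hc1. apply Rmult_le_reg_r with (c ^ 2); [nra|].
  field_simplify; [|lra].
  assert (H' := pow2_ge_0 (v c ^ 2 + c / 2)). nra. }
assert (HGlow : forall w, w < c -> 1 / 4 - (v w ^ 2 / - w - 1 / 2) ^ 2 <= G w).
{ intros w Hw. unfold G.
  replace (1 / 4 - (v w ^ 2 / - w - 1 / 2) ^ 2)
    with ((0 - w * v w ^ 2 - v w ^ 4) / w ^ 2) by (field; lra).
  apply Rmult_le_compat_r; [left; apply Rinv_0_lt_compat; nra|].
  assert (H' := pow2_ge_0 (v1 w)). lra. }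
(* The cap [1] turns a deviation of [r] below [e] into a squared deviation below [e]. *)
set (e := Rmin 1 (G c - G z)).
assert (He1 : e <= 1) by apply Rmin_l.
assert (He2 : e <= G c - G z) by apply Rmin_r.
assert (He0 : 0 < e) by (apply Rmin_pos; lra).
destruct (is_lim_m_infty_eps _ _ e Hlim He0) as [M HM].
set (w := Rmin M z - 1).
assert (Hw1 : w <= M - 1) by (assert (H' := Rmin_l M z); unfold w; lra).
assert (Hw2 : w <= z - 1) by (assert (H' := Rmin_r M z); unfold w; lra).
specialize (HM w ltac:(lra)). specialize (HGlow w ltac:(lra)).
assert (G w <= G z).
{ apply (nondecreasing_is_derive G G1); [lra| |].
  - intros; apply HG; lra.
  - intros; apply HG1nn; lra. }
set (r := v w ^ 2 / - w - 1 / 2) in *.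
assert (r ^ 2 < e) by (unfold r in *; nra).
lra.
Qed.

(** The last hypothesis says that the lower limit of [v] at [+oo] is nonnegative; a solution that
    decreases forever past a zero stays below the negative value [v (z + 1)]. *)
Lemma PII_positive (v v1 : R -> R) :
  (forall x, PII_ode_at v v1 x) ->
  is_lim (fun x => v x ^ 2 / - x) m_infty (1 / 2) ->
  (exists M, forall x, x < M -> 0 < v x) ->
  (forall c, 0 < c -> exists M, forall x, M < x -> - c < v x) ->
  forall x, 0 < v x.
Proof.
intros Hode Hlim [M HM] Hinf x. apply Rnot_le_lt; intros Hx.
assert (HMx : M <= x) by (apply Rnot_lt_le; intros H; specialize (HM x H); lra).
destruct (first_zero v (M - 1) x) as [z [Hz [Hvz Hpos]]]; [lra| |apply HM; lra|exact Hx|].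
{ intros w _. destruct (Hode w) as [H1 _]. now apply is_derive_continuous with (v1 w). }
assert (Hp : forall w, w < z -> 0 < v w).
{ intros w Hw. destruct (Rlt_le_dec w M); [now apply HM|]. apply Hpos; lra. }
assert (Hdec : forall p q, z <= p -> p < q -> v q < v p).
{ intros p q H1 H2. destruct (MVT_is_derive v v1 p q H2) as [e [E He]].
  { intros; apply Hode. }
  assert (H := PII_decreasing_after_zero v v1 z e Hode Hlim Hp Hvz ltac:(lra)). nra. }
assert (Hc : v (z + 1) < 0) by (rewrite <- Hvz; apply Hdec; lra).
destruct (Hinf (- v (z + 1))) as [N HN]; [lra|].
assert (H1 := Rmax_l N (z + 1)). assert (H2 := Rmax_r N (z + 1)).
specialize (HN (Rmax N (z + 1) + 1) ltac:(lra)).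
assert (H3 := Hdec (z + 1) (Rmax N (z + 1) + 1) ltac:(lra) ltac:(lra)). lra.
Qed.

(** At a maximum of [y / v] with value above [1], [y'' v - y v'' = 2 y v (y^2 - v^2)] would be
    positive. The interval runs from beyond [M] up to the supposed point where [y <= v]. *)
Lemma PII_ordered (v v1 y y1 : R -> R) (s : R) :
  (forall x, PII_ode_at v v1 x) -> (forall x, 0 < v x) ->
  (forall x, x < s -> PII_ode_at y y1 x) ->
  is_lim (fun x => y x / v x) m_infty 1 ->
  (exists M, forall x, x < M -> v x < y x) ->
  forall x, x < s -> v x < y x.
Proof.
intros Hv Hpos Hy Hlim [M HM] x Hx. apply Rnot_le_lt; intros Hle.
assert (HMx : M <= x) by (apply Rnot_lt_le; intros H; specialize (HM x H); lra).
assert (Hr : forall w, v w < y w <-> 1 < y w / v w).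
{ intros w. specialize (Hpos w). split; intros H.
  - apply Rmult_lt_reg_r with (v w); [lra|].
    replace (y w / v w * v w) with (y w) by (field; lra). lra.
  - apply Rmult_lt_compat_r with (r := v w) in H; [|lra].
    replace (y w / v w * v w) with (y w) in H by (field; lra). lra. }
destruct (ratio_interior_max y y1 (fun x => x * y x + 2 * y x ^ 3)
  v v1 (fun x => x * v x + 2 * v x ^ 3) 1 (M - 1) x) as [m [Hm [Hge Hd]]].
- intros w Hw. apply Hy; lra.
- intros w _. apply Hv.
- intros w _. apply Hpos.
- exact Hlim.
- lra.
- apply Hr, HM; lra.
- apply Rle_lt_trans with 1; [|apply Hr, HM; lra].
  apply Rnot_lt_le; intros H. apply Hr in H; lra.
- assert (H1 : v m < y m).
  { apply Hr. apply Rlt_le_trans with (2 := Hge). apply Hr, HM; lra. }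
  assert (Hvm := Hpos m).
  replace ((m * y m + 2 * y m ^ 3) * v m - y m * (m * v m + 2 * v m ^ 3))
    with (2 * (y m * v m * ((y m - v m) * (y m + v m)))) in Hd by ring.
  assert (0 < y m * v m * ((y m - v m) * (y m + v m))); [|lra].
  repeat apply Rmult_lt_0_compat; lra.
Qed.

(* Multiplying the equation by [y'] gives [y'^2 ~ y^4] near the pole, so [1 / y]
   tends to [0] with slope [-1]. *)
Lemma PII_pole_rate (y y1 : R -> R) (s e : R) : 0 < e ->
  (forall x, x < s -> PII_ode_at y y1 x) ->
  (forall K, exists d, 0 < d /\ forall x, s - d < x < s -> K < y x) ->
  exists d, 0 < d /\ forall x, s - d < x < s -> 1 - e <= (s - x) * y x <= 1 + e.
Proof.
intros He Hode Hinf.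
set (q := Rmin (1 / 4) (e / 4)).
assert (Hq4 : q <= 1 / 4) by apply Rmin_l.
assert (Hqe : q <= e / 4) by apply Rmin_r.
assert (Hq0 : 0 < q) by (apply Rmin_pos; lra).
(* Half of the tolerance [q] absorbs the forcing term [x y], the other half the initial values of
   the two energies below. *)
set (p := q / 2).
destruct (Hinf (1 + (Rabs s + 1) / (2 * p))) as [d0 [Hd0 Hy0]].
assert (HA : 0 <= Rabs s) by apply Rabs_pos.
assert (HA1 := Rle_abs s). assert (HA2 := Rle_abs (- s)). rewrite Rabs_Ropp in HA2.
assert (HK : 0 < (Rabs s + 1) / (2 * p)) by (apply Rdiv_lt_0_compat; unfold p; lra).
set (x0 := s - Rmin (d0 / 2) 1).
assert (Hm1 : Rmin (d0 / 2) 1 <= d0 / 2) by apply Rmin_l.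
assert (Hm2 : Rmin (d0 / 2) 1 <= 1) by apply Rmin_r.
assert (Hm3 : 0 < Rmin (d0 / 2) 1) by (apply Rmin_pos; lra).
assert (Hbig : forall x, x0 <= x < s -> 1 < y x /\ - (2 * p * y x ^ 2) < x < 2 * p * y x ^ 2).
{ intros x Hx. specialize (Hy0 x ltac:(unfold x0 in *; lra)).
  assert (H : Rabs s + 1 < 2 * p * y x ^ 2).
  { replace (Rabs s + 1) with (2 * p * ((Rabs s + 1) / (2 * p))) at 1
      by (field; unfold p; lra).
    apply Rmult_lt_compat_l; [unfold p; lra|]. nra. }
  unfold x0 in *. split; [lra|]. split; lra. }
(* Since [y] is unbounded it must rise somewhere; from then on [y'' > 0] keeps [y'] positive. *)
assert (Hx1 : exists x1, x0 <= x1 < s /\ 0 < y1 x1).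
{ destruct (Hinf (y x0)) as [d [Hd Hy]].
  set (z := s - Rmin (d / 2) (Rmin (d0 / 2) 1 / 2)).
  assert (H1 : Rmin (d / 2) (Rmin (d0 / 2) 1 / 2) <= d / 2) by apply Rmin_l.
  assert (H2 : Rmin (d / 2) (Rmin (d0 / 2) 1 / 2) <= Rmin (d0 / 2) 1 / 2) by apply Rmin_r.
  assert (H3 : 0 < Rmin (d / 2) (Rmin (d0 / 2) 1 / 2)) by (apply Rmin_pos; lra).
  specialize (Hy z ltac:(unfold z; lra)).
  destruct (MVT_is_derive y y1 x0 z) as [c [E Hc]].
  - unfold x0, z; lra.
  - intros x Hx. apply Hode. unfold z in *; lra.
  - exists c. unfold z, x0 in *. split; [lra|].
    assert (0 < y1 c * (s - Rmin (d / 2) (Rmin (d0 / 2) 1 / 2) - (s - Rmin (d0 / 2) 1))) by lra.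
    nra. }
destruct Hx1 as [x1 [Hx1 Hy1]].
assert (Hy1pos : forall x, x1 <= x < s -> 0 < y1 x).
{ intros x Hx. apply Rlt_le_trans with (1 := Hy1).
  apply nondecreasing_is_derive with (fun x => x * y x + 2 * y x ^ 3); [lra| |].
  - intros w Hw. apply Hode; lra.
  - intros w Hw. destruct (Hbig w ltac:(lra)) as [Hb1 Hb2].
    replace (w * y w + 2 * y w ^ 3) with (y w * (w + 2 * y w ^ 2)) by ring.
    apply Rmult_le_pos; [lra|]. unfold p in *. nra. }
(* The derivative of [y'^2 - y^4] is [2 x y y'], of no definite sign; adding or subtracting [p y^4]
   makes it definite once [y^2] dominates [x]. *)
set (P := fun x => y1 x ^ 2 - (1 - p) * y x ^ 4).
set (Q := fun x => (1 + p) * y x ^ 4 - y1 x ^ 2).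
assert (HP : forall x, x1 <= x < s -> P x1 <= P x).
{ intros x Hx. apply nondecreasing_is_derive with
    (fun x => 2 * (y1 x * y x * (x + 2 * p * y x ^ 2))); [lra| |].
  - intros w Hw. destruct (Hode w ltac:(lra)) as [H1 H2]. unfold P. derive_known.
  - intros w Hw. destruct (Hbig w ltac:(lra)) as [Hb1 Hb2].
    specialize (Hy1pos w ltac:(lra)).
    assert (0 <= y1 w * y w * (w + 2 * p * y w ^ 2)); [|lra].
    apply Rmult_le_pos; [apply Rmult_le_pos|]; lra. }
assert (HQ : forall x, x1 <= x < s -> Q x1 <= Q x).
{ intros x Hx. apply nondecreasing_is_derive with
    (fun x => 2 * (y1 x * y x * (2 * p * y x ^ 2 - x))); [lra| |].
  - intros w Hw. destruct (Hode w ltac:(lra)) as [H1 H2]. unfold Q. derive_known.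
  - intros w Hw. destruct (Hbig w ltac:(lra)) as [Hb1 Hb2].
    specialize (Hy1pos w ltac:(lra)).
    assert (0 <= y1 w * y w * (2 * p * y w ^ 2 - w)); [|lra].
    apply Rmult_le_pos; [apply Rmult_le_pos|]; lra. }
destruct (Hinf (1 + (Rabs (P x1) + Rabs (Q x1)) / p)) as [d2 [Hd2 Hy2]].
assert (HPa := Rabs_pos (P x1)). assert (HQa := Rabs_pos (Q x1)).
assert (HPb := Rle_abs (- P x1)). assert (HQb := Rle_abs (- Q x1)).
rewrite Rabs_Ropp in HPb, HQb.
set (d := Rmin d2 (s - x1)).
assert (Hda : d <= d2) by apply Rmin_l.
assert (Hdb : d <= s - x1) by apply Rmin_r.
assert (Hd : 0 < d) by (apply Rmin_pos; lra).
assert (Hrate : forall x, s - d < x < s ->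
  1 < y x /\ (1 - q) * y x ^ 2 <= y1 x <= (1 + q) * y x ^ 2).
{ intros x Hx. destruct (Hbig x ltac:(lra)) as [Hyx _].
  specialize (HP x ltac:(lra)). specialize (HQ x ltac:(lra)).
  specialize (Hy2 x ltac:(lra)). specialize (Hy1pos x ltac:(lra)).
  assert (HR : Rabs (P x1) + Rabs (Q x1) <= p * y x ^ 4).
  { replace (Rabs (P x1) + Rabs (Q x1))
      with (p * ((Rabs (P x1) + Rabs (Q x1)) / p)) by (field; unfold p; lra).
    apply Rmult_le_compat_l; [unfold p; lra|].
    apply Rle_trans with (y x); [lra|].
    assert (1 <= y x ^ 3) by (apply pow_R1_Rle; lra).
    replace (y x ^ 4) with (y x * y x ^ 3) by ring. nra. }
  unfold P, Q in HP, HQ. fold (P x1) in HP. fold (Q x1) in HQ.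
  assert (Hlo : (1 - q) * y x ^ 4 <= y1 x ^ 2) by (unfold p in *; lra).
  assert (Hhi : y1 x ^ 2 <= (1 + q) * y x ^ 4) by (unfold p in *; lra).
  assert (Hy4 : 0 < y x ^ 4) by (apply pow_lt; lra).
  split; [exact Hyx|]. split.
  - apply Rsqr_incr_0_var; [|lra]. unfold Rsqr.
    replace ((1 - q) * y x ^ 2 * ((1 - q) * y x ^ 2)) with ((1 - q) * ((1 - q) * y x ^ 4)) by ring.
    nra.
  - apply Rsqr_incr_0_var; [|nra]. unfold Rsqr.
    replace ((1 + q) * y x ^ 2 * ((1 + q) * y x ^ 2)) with ((1 + q) * ((1 + q) * y x ^ 4)) by ring.
    nra. }
exists d. split; [exact Hd|]. intros x Hx.
(* The function [- 1 / y] has derivative [y' / y^2], within [q] of [1]. Letting [z] tend to the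
   pole, where [1 / y] vanishes, gives [Hlim]. *)
assert (Hinv : forall z, x < z < s ->
  (1 - q) * (z - x) <= / y x - / y z <= (1 + q) * (z - x)).
{ intros z Hz.
  destruct (MVT_is_derive (fun x => - / y x) (fun x => y1 x / y x ^ 2) x z) as [c [E Hc]].
  - lra.
  - intros w Hw. destruct (Hode w ltac:(lra)) as [H1 H2].
    destruct (Hrate w ltac:(lra)) as [H3 _]. derive_known; [lra|]. simpl. field. lra.
  - destruct (Hrate c ltac:(lra)) as [H3 H4].
    replace (/ y x - / y z) with (y1 c / y c ^ 2 * (z - x)) by lra.
    assert (Hc2 : 0 < y c ^ 2) by nra.
    split; (apply Rmult_le_compat_r; [lra|]);
      (apply Rmult_le_reg_r with (y c ^ 2); [lra|]);
      unfold Rdiv; rewrite Rmult_assoc, Rinv_l; lra. }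
destruct (Hrate x Hx) as [Hyx _].
assert (Hlim : (1 - q) * (s - x) <= / y x <= (1 + q) * (s - x)).
{ split; apply le_epsilon; intros h Hh.
  - set (r := Rmin (h / 2) ((s - x) / 2)).
    assert (H1 : r <= h / 2) by apply Rmin_l.
    assert (H2 : r <= (s - x) / 2) by apply Rmin_r.
    assert (H3 : 0 < r) by (apply Rmin_pos; lra).
    destruct (Hinv (s - r) ltac:(lra)) as [H4 _].
    destruct (Hrate (s - r) ltac:(lra)) as [H5 _].
    assert (0 < / y (s - r)) by (apply Rinv_0_lt_compat; lra). nra.
  - destruct (Hinf (/ h)) as [d3 [Hd3 Hy3]].
    set (r := Rmin (d3 / 2) ((s - x) / 2)).
    assert (H1 : r <= d3 / 2) by apply Rmin_l.
    assert (H2 : r <= (s - x) / 2) by apply Rmin_r.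
    assert (H3 : 0 < r) by (apply Rmin_pos; lra).
    destruct (Hinv (s - r) ltac:(lra)) as [_ H4].
    specialize (Hy3 (s - r) ltac:(lra)).
    assert (H5 : / y (s - r) < / / h).
    { apply Rinv_lt_contravar; [|exact Hy3].
      assert (0 < / h) by now apply Rinv_0_lt_compat.
      apply Rmult_lt_0_compat; lra. }
    rewrite Rinv_inv in H5. nra. }
assert (Hyi : y x * / y x = 1) by (field; lra).
assert (Hu : (1 - q) * ((s - x) * y x) <= 1) by nra.
assert (Hl : 1 <= (1 + q) * ((s - x) * y x)) by nra.
set (w := (s - x) * y x) in *.
split; nra.
Qed.

(** * Analytic germs, poles, and decay of the Airy integral *)

Lemma analytic_at_ex_derive (f : R -> R) (x0 : R) : analytic_at f x0 -> ex_derive f x0.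
Proof.
intros [c Hc].
(* [analytic_at] records only pointwise convergence; convergence at the single point [d / 2] already
   forces a positive radius, since the terms do not tend to zero outside the disk. *)
assert (Hrad : Rbar_lt 0 (CV_radius c)).
{ destruct Hc as [d Hd]. assert (Hdp := cond_pos d).
  apply Rbar_lt_le_trans with (Finite (d / 2)); [simpl; lra|].
  apply Rbar_not_lt_le; intros Hlt.
  assert (Hs : ex_pseries c (d / 2)).
  { exists (f (x0 + d / 2)).
    assert (H : is_pseries c (x0 + d / 2 - x0) (f (x0 + d / 2))).
    { apply Hd. apply Rabs_def1; unfold minus, plus, opp; simpl; lra. }
    replace (x0 + d / 2 - x0) with (d / 2) in H by ring. exact H. }
  apply (CV_disk_outside c (d / 2)).
  - rewrite Rabs_pos_eq by lra. exact Hlt.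
  - apply ex_series_lim_0. apply ex_series_ext with (2 := proj1 (ex_pseries_R _ _) Hs).
    reflexivity. }
apply ex_derive_ext_loc with (fun x => PSeries c (x - x0)).
- revert Hc. apply filter_imp. intros x Hx. now apply is_pseries_unique.
- apply (ex_derive_comp (PSeries c) (fun x => x - x0)).
  + apply ex_derive_PSeries. rewrite Rminus_diag, Rabs_R0. exact Hrad.
  + auto_derive. exact I.
Qed.

(** Within distance [1] of [s] a pole of order [m >= 1] is at least as strong as a simple one, and
    [g] keeps half of its size near [s] by continuity. *)
Lemma pole_unbounded (f : R -> R) (s K : R) : is_pole f s ->
  exists d, 0 < d /\ forall x, x <> s -> s - d < x < s + d -> K < Rabs (f x).
Proof.
intros [m [g [Hm [Hg [Hg0 Hf]]]]].
assert (Hc : continuous g s) by (apply (ex_derive_continuous g s), analytic_at_ex_derive, Hg).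
assert (Hgp : 0 < Rabs (g s)) by now apply Rabs_pos_lt.
assert (Hloc : locally s (fun x => Rabs (g s) / 2 < Rabs (g x))).
{ assert (Hc' : continuous (fun x => Rabs (g x)) s)
    by (apply (continuous_comp g Rabs); [exact Hc|apply continuous_Rabs]).
  apply (Hc' (fun z => Rabs (g s) / 2 < z)). apply open_gt. lra. }
destruct Hloc as [d1 H1]. destruct Hf as [d2 H2].
assert (Hd1 := cond_pos d1). assert (Hd2 := cond_pos d2).
set (B := Rabs K + 1). assert (HB : 0 < B) by (assert (H := Rabs_pos K); unfold B; lra).
assert (HBK : K < B) by (assert (H := Rle_abs K); unfold B; lra).
set (d := Rmin (Rmin d1 d2) (Rmin 1 (Rabs (g s) / 2 / B))).
assert (D1 : d <= Rmin d1 d2) by apply Rmin_l.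
assert (D2 : d <= Rmin 1 (Rabs (g s) / 2 / B)) by apply Rmin_r.
assert (D3 := Rmin_l d1 d2). assert (D4 := Rmin_r d1 d2).
assert (D5 := Rmin_l 1 (Rabs (g s) / 2 / B)). assert (D6 := Rmin_r 1 (Rabs (g s) / 2 / B)).
assert (D0 : 0 < d).
{ repeat apply Rmin_pos; try lra. apply Rdiv_lt_0_compat; lra. }
exists d. split; [exact D0|]. intros x Hne Hx.
assert (Hball : forall d' : posreal, d <= d' -> ball s d' x).
{ intros d' Hd'. apply Rabs_def1; unfold minus, plus, opp; simpl; lra. }
rewrite (H2 x (Hball d2 ltac:(lra)) Hne).
specialize (H1 x (Hball d1 ltac:(lra))).
assert (Hu0 : 0 < Rabs (x - s)) by (apply Rabs_pos_lt; lra).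
assert (Hud : Rabs (x - s) < d) by (apply Rabs_def1; lra).
unfold Rdiv. rewrite Rabs_mult, Rabs_inv, <- RPow_abs.
set (u := Rabs (x - s)) in *.
assert (Hum : u ^ m <= u).
{ destruct m as [|m]; [lia|]. simpl.
  assert (u ^ m <= 1); [|nra]. rewrite <- (pow1 m). apply pow_incr; lra. }
assert (Hum0 : 0 < u ^ m) by now apply pow_lt.
apply Rlt_trans with (1 := HBK).
apply Rmult_lt_reg_r with (u ^ m); [exact Hum0|].
rewrite Rmult_assoc, Rinv_l, Rmult_1_r by lra.
apply Rle_lt_trans with (2 := H1).
apply Rle_trans with (B * u); [nra|].
apply Rle_trans with (B * (Rabs (g s) / 2 / B)); [nra|]. right. field. lra.
Qed.

(** Exclusion is not built into the definitions, since [is_pole] ignores the value at [s]; it comes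
    from local boundedness. *)
Lemma analytic_at_not_pole (f : R -> R) (s : R) : analytic_at f s -> ~ is_pole f s.
Proof.
intros Ha Hp.
assert (Hc : continuous (fun x => Rabs (f x)) s).
{ apply (continuous_comp f Rabs); [|apply continuous_Rabs].
  apply (ex_derive_continuous f s), analytic_at_ex_derive, Ha. }
assert (Hloc : locally s (fun x => Rabs (f x) < Rabs (f s) + 1)).
{ apply (Hc (fun z => z < Rabs (f s) + 1)). apply open_lt. lra. }
destruct Hloc as [d1 H1]. assert (Hd1 := cond_pos d1).
destruct (pole_unbounded f s (Rabs (f s) + 1) Hp) as [d [Hd H]].
assert (D1 := Rmin_l d1 d). assert (D2 := Rmin_r d1 d).
assert (D3 : 0 < Rmin d1 d) by (apply Rmin_pos; lra).
specialize (H (s + Rmin d1 d / 2) ltac:(lra) ltac:(lra)).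
specialize (H1 (s + Rmin d1 d / 2)).
assert (ball s d1 (s + Rmin d1 d / 2))
  by (apply Rabs_def1; unfold minus, plus, opp; simpl; lra).
specialize (H1 H0). lra.
Qed.

Lemma PII_solution_ode (y : R -> R) (x : R) :
  PII_solution y -> ~ is_pole y x -> PII_ode_at y (Derive y) x.
Proof.
intros [Hm Hd] Hx. split.
- apply Derive_correct, analytic_at_ex_derive. destruct (Hm x); tauto.
- exact (Hd x Hx).
Qed.

(* Integration by parts against the phase [s^3/3 + x s], whose derivative is
   [s^2 + x]. *)
Lemma Airy_tail (x a b : R) : 0 < x -> 0 <= a <= b ->
  Rabs (RInt (fun s => cos (s ^ 3 / 3 + x * s)) 0 b
        - RInt (fun s => cos (s ^ 3 / 3 + x * s)) 0 a) <= 3 / (a ^ 2 + x).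
Proof.
intros Hx Hab.
set (f := fun s => cos (s ^ 3 / 3 + x * s)).
set (F := fun T => RInt f 0 T).
assert (Hcont : forall s, continuous f s).
{ intros s. apply (ex_derive_continuous f s). unfold f. auto_derive. exact I. }
assert (HF : forall s, is_derive F s (f s)).
{ intros s. apply is_derive_RInt with 0; [|apply Hcont].
  apply filter_forall. intros T. apply RInt_correct, ex_RInt_continuous.
  intros z _. apply Hcont. }
set (H := fun s => sin (s ^ 3 / 3 + x * s) / (s ^ 2 + x)).
set (k := fun s => - / (s ^ 2 + x)).
assert (Hpos : forall s, 0 < s ^ 2 + x) by (intros s; assert (E := pow2_ge_0 s); lra).
assert (HHd : forall s, is_derive H s
  (f s - sin (s ^ 3 / 3 + x * s) * (2 * s) / (s ^ 2 + x) ^ 2)).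
{ intros s. unfold H, f. specialize (Hpos s). auto_derive; [simpl in *; lra|].
  replace (s * (s * (s * 1)) / 3 + x * s) with (s ^ 3 / 3 + x * s) by (simpl; ring).
  replace (s * (s * (s * 1)) * / 3 + x * s) with (s ^ 3 / 3 + x * s) by (simpl; field).
  simpl in *. field. lra. }
assert (Hkd : forall s, is_derive k s (2 * s / (s ^ 2 + x) ^ 2)).
{ intros s. unfold k. specialize (Hpos s). auto_derive; simpl in *; [lra|]. field. lra. }
(* [F - H] has derivative [2 s / (s^2 + x)^2] times a sine, which the derivative of [k] dominates.
   The terms [H a], [H b] and [k b - k a] are each at most [1 / (a^2 + x)] in size, which accounts
   for the [3]. *)
assert (Hup : (F a - H a) + k a <= (F b - H b) + k b).
{ apply (nondecreasing_is_derive (fun s => (F s - H s) + k s)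
    (fun s => (f s - (f s - sin (s ^ 3 / 3 + x * s) * (2 * s) / (s ^ 2 + x) ^ 2))
              + 2 * s / (s ^ 2 + x) ^ 2)); [lra| |].
  - intros s Hs. specialize (HF s). specialize (HHd s). specialize (Hkd s). derive_known.
  - intros s Hs. specialize (Hpos s).
    assert (B := SIN_bound (s ^ 3 / 3 + x * s)).
    match goal with |- 0 <= ?e => replace e with
      (2 * s * (1 + sin (s ^ 3 / 3 + x * s)) / (s ^ 2 + x) ^ 2) by (field; lra) end.
    apply Rdiv_le_0_compat; [|nra]. apply Rmult_le_pos; lra. }
assert (Hdn : k a - (F a - H a) <= k b - (F b - H b)).
{ apply (nondecreasing_is_derive (fun s => k s - (F s - H s))
    (fun s => 2 * s / (s ^ 2 + x) ^ 2
     - (f s - (f s - sin (s ^ 3 / 3 + x * s) * (2 * s) / (s ^ 2 + x) ^ 2)))); [lra| |].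
  - intros s Hs. specialize (HF s). specialize (HHd s). specialize (Hkd s). derive_known.
  - intros s Hs. specialize (Hpos s).
    assert (B := SIN_bound (s ^ 3 / 3 + x * s)).
    match goal with |- 0 <= ?e => replace e with
      (2 * s * (1 - sin (s ^ 3 / 3 + x * s)) / (s ^ 2 + x) ^ 2) by (field; lra) end.
    apply Rdiv_le_0_compat; [|nra]. apply Rmult_le_pos; lra. }
assert (HHb : forall s, - / (s ^ 2 + x) <= H s <= / (s ^ 2 + x)).
{ intros s. unfold H, Rdiv. assert (B := SIN_bound (s ^ 3 / 3 + x * s)).
  assert (0 < / (s ^ 2 + x)) by now apply Rinv_0_lt_compat. split; nra. }
assert (Ha := HHb a). assert (Hb := HHb b).
assert (Hkk : / (b ^ 2 + x) <= / (a ^ 2 + x)).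
{ apply Rinv_le_contravar; [apply Hpos|nra]. }
assert (0 < / (b ^ 2 + x)) by now apply Rinv_0_lt_compat.
unfold k in *. fold (F a) (F b). unfold Rdiv. apply Rabs_le. split; lra.
Qed.

(** [RInt_gen] has a usable value only once convergence is known, so the tail bound first serves as
    a Cauchy criterion; with lower limit [0] it then bounds the value. *)
Lemma Ai_bound (x : R) : 0 < x -> Rabs (Ai x) <= 3 / x / PI.
Proof.
intros Hx. set (f := fun s => cos (s ^ 3 / 3 + x * s)).
set (F := fun T => RInt f 0 T).
assert (Hcv : exists l, filterlim F (Rbar_locally p_infty) (locally l)).
{ apply filterlim_locally_cauchy. intros eps.
  exists (fun T => 1 + 3 / eps < T). split; [now exists (1 + 3 / eps)|].
  assert (Heps := cond_pos eps).
  assert (H3 : 0 < 3 / eps) by (apply Rdiv_lt_0_compat; lra).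
  assert (Hw : forall u v, 1 + 3 / eps < u -> u <= v -> Rabs (F v - F u) < eps).
  { intros u v Hu Hv. apply Rle_lt_trans with (3 / (u ^ 2 + x)).
    - apply Airy_tail; lra.
    - apply Rmult_lt_reg_r with (u ^ 2 + x); [nra|].
      unfold Rdiv at 1. rewrite Rmult_assoc, Rinv_l, Rmult_1_r by nra.
      assert (3 = eps * (3 / eps)) by (field; lra).
      assert (3 / eps < u ^ 2 + x) by nra. nra. }
  intros u v Hu Hv. destruct (Rle_lt_dec u v) as [Huv|Huv].
  - apply (Hw u v Hu Huv).
  - apply ball_sym. apply (Hw v u Hv). lra. }
destruct Hcv as [l Hl].
assert (Hgen : is_RInt_gen f (at_point 0) (Rbar_locally p_infty) l).
{ intros P HP. apply Filter_prod with (fun u => u = 0) (fun T => P (F T)).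
  - reflexivity.
  - apply Hl. exact HP.
  - intros u T -> HT. exists (F T). split; [|exact HT]. simpl.
    apply (RInt_correct f), ex_RInt_continuous. intros z _.
    apply (ex_derive_continuous f z). unfold f. auto_derive. exact I. }
unfold Ai. fold f. rewrite (is_RInt_gen_unique f l Hgen).
assert (Hl3 : Rabs l <= 3 / x).
{ apply (is_lim_le_loc (fun T => Rabs (F T)) (fun _ => 3 / x) p_infty (Rabs l) (3 / x)).
  - exists 0. intros T HT. assert (H := Airy_tail x 0 T Hx ltac:(lra)).
    rewrite RInt_point in H. unfold zero in H; simpl in H.
    rewrite Rminus_0_r in H. replace (0 * (0 * 1) + x) with x in H by ring. exact H.
  - apply (filterlim_comp _ _ _ F Rabs _ (locally l)); [exact Hl|apply continuous_Rabs].
  - apply is_lim_const. }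
assert (HPI := PI_RGT_0).
rewrite Rabs_mult, Rabs_inv, (Rabs_pos_eq PI) by lra. unfold Rdiv at 1.
rewrite Rmult_comm. apply Rmult_le_compat_r; [|exact Hl3].
left. now apply Rinv_0_lt_compat.
Qed.

(** * The rescaled recurrence *)

(** The second difference is studied as a function of its step [r]: the [r]-derivative is a first
    difference of [u'], controlled by the mean value theorem. Bounds on [u''] suffice. *)
Lemma second_difference (u u1 u2 : R -> R) (x h m e : R) : 0 < h ->
  (forall z, x - h <= z <= x + h -> is_derive u z (u1 z)) ->
  (forall z, x - h <= z <= x + h -> is_derive u1 z (u2 z)) ->
  (forall z, x - h <= z <= x + h -> m - e <= u2 z <= m + e) ->
  h ^ 2 * (m - e) <= u (x + h) + u (x - h) - 2 * u x <= h ^ 2 * (m + e).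
Proof.
intros Hh H1 H2 Hb.
assert (Hdiff : forall r, 0 < r <= h ->
  2 * r * (m - e) <= u1 (x + r) - u1 (x - r) <= 2 * r * (m + e)).
{ intros r Hr. destruct (MVT_is_derive u1 u2 (x - r) (x + r)) as [c [E Hc]]; [lra| |].
  - intros z Hz. apply H2; lra.
  - specialize (Hb c ltac:(lra)). rewrite E. split; nra. }
assert (Hd : forall (sg K r : R), 0 <= r <= h ->
  is_derive (fun r => sg * (u (x + r) + u (x - r) - r ^ 2 * K)) r
            (sg * (u1 (x + r) - u1 (x - r) - 2 * r * K))).
{ intros sg K r Hr.
  assert (Hp := H1 (x + r) ltac:(lra)). assert (Hm := H1 (x - r) ltac:(lra)).
  auto_derive.
  - repeat split; [exists (u1 (x + r))|exists (u1 (x - r))]; assumption.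
  - replace (x + - r) with (x - r) by ring.
    rewrite (is_derive_unique (fun t : R => u t) (x + r) _ Hp).
    rewrite (is_derive_unique (fun t : R => u t) (x - r) _ Hm). simpl. ring. }
split.
- assert (H := nondecreasing_is_derive
    (fun r => 1 * (u (x + r) + u (x - r) - r ^ 2 * (m - e)))
    (fun r => 1 * (u1 (x + r) - u1 (x - r) - 2 * r * (m - e))) 0 h).
  cbv beta in H. rewrite Rplus_0_r, Rminus_0_r in H.
  assert (1 * (u x + u x - 0 ^ 2 * (m - e))
          <= 1 * (u (x + h) + u (x - h) - h ^ 2 * (m - e))); [|simpl in *; lra].
  apply H; [lra| |].
  + intros r Hr. now apply Hd.
  + intros r Hr. specialize (Hdiff r ltac:(lra)). lra.
- assert (H := nondecreasing_is_derive
    (fun r => -1 * (u (x + r) + u (x - r) - r ^ 2 * (m + e)))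
    (fun r => -1 * (u1 (x + r) - u1 (x - r) - 2 * r * (m + e))) 0 h).
  cbv beta in H. rewrite Rplus_0_r, Rminus_0_r in H.
  assert (-1 * (u x + u x - 0 ^ 2 * (m + e))
          <= -1 * (u (x + h) + u (x - h) - h ^ 2 * (m + e))); [|simpl in *; lra].
  apply H; [lra| |].
  + intros r Hr. now apply Hd.
  + intros r Hr. specialize (Hdiff r ltac:(lra)). lra.
Qed.

Lemma second_difference_uniform (u u1 u2 : R -> R) (L eta e : R) :
  0 < eta < L -> 0 < e ->
  (forall z, z < 0 -> is_derive u z (u1 z) /\ is_derive u1 z (u2 z) /\ continuous u2 z) ->
  exists h0, 0 < h0 /\ forall h x, 0 < h < h0 -> - L <= x <= - eta ->
    x + h < 0 /\
    h ^ 2 * (u2 x - e) <= u (x + h) + u (x - h) - 2 * u x <= h ^ 2 * (u2 x + e).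
Proof.
intros HL He Hu.
destruct (unifcont_1d u2 (- (L + 1)) (- (eta / 2))
  (fun z Hz => proj2 (proj2 (Hu z ltac:(lra)))) (mkposreal e He)) as [d Hd].
assert (Hdp := cond_pos d).
exists (Rmin d (Rmin 1 (eta / 2))).
assert (M1 := Rmin_l d (Rmin 1 (eta / 2))). assert (M2 := Rmin_r d (Rmin 1 (eta / 2))).
assert (M3 := Rmin_l 1 (eta / 2)). assert (M4 := Rmin_r 1 (eta / 2)).
split; [repeat apply Rmin_pos; lra|]. intros h x Hh Hx. split; [lra|].
apply (second_difference u u1 u2); [lra|intros; apply Hu; lra..|].
intros z Hz.
assert (Hball : Rabs (u2 z - u2 x) < e); [|apply Rabs_def2 in Hball; lra].
(* [unifcont_1d] yields a doubly negated conclusion, hence the proof by contradiction. *)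
apply Rnot_le_lt; intros Hn.
apply (Hd x z); [lra|lra| |].
- apply Rabs_def1; unfold minus, plus, opp; simpl; lra.
- intros Hb. apply (Rlt_not_le _ _ Hb Hn).
Qed.

(** After division by [(1 + de) h] or [(1 - de) h] the linear terms agree to order [h^2], while the
    cubic term carries the squared factor. The gap is at least [2 de u^3 h^2], and [e] is small
    enough for the errors [e (1 + 2 u) h^2] to fit into it. *)
Lemma recurrence_strict_perturbation (u u1 : R -> R) (s L eta de : R) :
  0 < eta < L -> 0 < de < 1 ->
  (forall z, z < 0 -> is_derive u z (u1 z) /\
     is_derive u1 z (2 * (z + s) * u z + 2 * u z ^ 3) /\ 0 < u z) ->
  exists h0 e, 0 < h0 /\ 0 < e /\ forall h x c, 0 < h < h0 -> - L <= x <= - eta ->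
    Rabs (c - 1 - h ^ 2 * (x + s)) <= e * h ^ 2 ->
    ((1 + de) * h * u x < 1 ->
     (1 + de) * h * u (x + h) + (1 + de) * h * u (x - h)
     <= c * (2 * ((1 + de) * h * u x) / (1 - ((1 + de) * h * u x) ^ 2))) /\
    (1 - de) * h * u x < 1 /\
    c * (2 * ((1 - de) * h * u x) / (1 - ((1 - de) * h * u x) ^ 2))
    <= (1 - de) * h * u (x + h) + (1 - de) * h * u (x - h).
Proof.
intros HL Hde Hu.
set (u2 := fun z => 2 * (z + s) * u z + 2 * u z ^ 3).
assert (Hc : forall z, - L <= z <= - eta -> continuity_pt u z).
{ intros z Hz. apply is_derive_continuity_pt with (u1 z). apply Hu; lra. }
destruct (continuity_ab_maj u (- L) (- eta) ltac:(lra) Hc) as [xM [HM HxM]].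
destruct (continuity_ab_min u (- L) (- eta) ltac:(lra) Hc) as [xm [Hm Hxm]].
assert (Hmu := proj2 (proj2 (Hu xm ltac:(lra)))).
set (M := u xM) in *. set (mu := u xm) in *.
assert (HmM : mu <= M) by (apply Hm; lra).
set (e := Rmin 1 (mu ^ 3 * de / (1 + 2 * M))).
assert (Hmu3 : 0 < mu ^ 3) by now apply pow_lt.
assert (He1 : e <= 1) by apply Rmin_l.
assert (He2 : e * (1 + 2 * M) <= mu ^ 3 * de).
{ apply Rle_trans with (mu ^ 3 * de / (1 + 2 * M) * (1 + 2 * M)).
  - apply Rmult_le_compat_r; [lra|apply Rmin_r].
  - right; field; lra. }
assert (He0 : 0 < e).
{ apply Rmin_pos; [lra|]. apply Rdiv_lt_0_compat; [nra|lra]. }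
destruct (second_difference_uniform u u1 u2 L eta e HL He0) as [h1 [Hh1 Hdiff]].
{ intros z Hz. destruct (Hu z Hz) as [D1 [D2 _]]. split; [exact D1|split; [exact D2|]].
  apply is_derive_continuous with (2 * u z + 2 * (z + s) * u1 z + 6 * u z ^ 2 * u1 z).
  unfold u2. derive_known. }
(* A common bound, per [h^2], for the second difference of [u] from above and for the drop of [c]
   below [1]. *)
set (C := 2 * (L + Rabs s) * M + 2 * M ^ 3 + 2 + L + Rabs s).
assert (Hs0 := Rabs_pos s). assert (Hs1 := Rle_abs s).
assert (Hs2 := Rle_abs (- s)). rewrite Rabs_Ropp in Hs2.
assert (HM3 : 0 < M ^ 3) by (apply pow_lt; lra).
assert (HLM : 0 <= (L + Rabs s) * M) by (apply Rmult_le_pos; lra).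
assert (HC : 0 < C) by (unfold C; lra).
(* In order: [h^2 <= h]; the losses of the supersolution and of the subsolution stay within their
   margins; [h u <= 1/2]. *)
set (b := Rmin (Rmin 1 (de / 4 / C)) (Rmin (mu * de / C) (/ (2 * M)))).
assert (Hb1 : b <= 1) by (unfold b; eapply Rle_trans; [apply Rmin_l|apply Rmin_l]).
assert (Hb2 : b * C <= de / 4).
{ apply Rle_trans with (de / 4 / C * C); [|right; field; lra].
  apply Rmult_le_compat_r; [lra|]. unfold b; eapply Rle_trans; [apply Rmin_l|apply Rmin_r]. }
assert (Hb3 : b * C <= mu * de).
{ apply Rle_trans with (mu * de / C * C); [|right; field; lra].
  apply Rmult_le_compat_r; [lra|]. unfold b; eapply Rle_trans; [apply Rmin_r|apply Rmin_l]. }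
assert (Hb4 : b * M <= 1 / 2).
{ apply Rle_trans with (/ (2 * M) * M); [|right; field; lra].
  apply Rmult_le_compat_r; [lra|]. unfold b; eapply Rle_trans; [apply Rmin_r|apply Rmin_r]. }
assert (Hb0 : 0 < b).
{ unfold b. repeat apply Rmin_pos; [lra| | |].
  - repeat apply Rdiv_lt_0_compat; lra.
  - apply Rdiv_lt_0_compat; [nra|lra].
  - apply Rinv_0_lt_compat; lra. }
exists (Rmin h1 b), e. split; [now apply Rmin_pos|]. split; [exact He0|].
intros h x c Hh Hx Hcx.
assert (Hhh1 := Rmin_l h1 b). assert (Hhb := Rmin_r h1 b).
destruct (Hdiff h x ltac:(lra) Hx) as [_ Hd]. unfold u2 in Hd.
apply Rabs_le_between in Hcx.
assert (HuM := HM x Hx). assert (Hum := Hm x Hx).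
set (U := u x) in *. set (S := u (x + h) + u (x - h)) in *.
replace (u (x + h) + u (x - h) - 2 * U) with (S - 2 * U) in Hd by (unfold S; ring).
assert (HU3 : mu ^ 3 <= U ^ 3) by (apply pow_incr; lra).
assert (HU3M : U ^ 3 <= M ^ 3) by (apply pow_incr; lra).
set (k := h ^ 2) in *.
assert (Hk0 : 0 < k) by (unfold k; nra).
assert (Hkb : k <= b) by (unfold k; nra).
assert (HkC : k * C <= de / 4) by (apply Rle_trans with (b * C); [apply Rmult_le_compat_r; lra|lra]).
assert (HkC' : k * C <= mu * de) by (apply Rle_trans with (b * C); [apply Rmult_le_compat_r; lra|lra]).
assert (HeU : e * (1 + 2 * U) <= mu ^ 3 * de).
{ apply Rle_trans with (2 := He2). apply Rmult_le_compat_l; lra. }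
assert (HxU : (x + s) * U <= (L + Rabs s) * M).
{ apply Rle_trans with ((L + Rabs s) * U); [apply Rmult_le_compat_r; lra|].
  apply Rmult_le_compat_l; lra. }
assert (HSup : S <= 2 * U + k * C).
{ assert (k * (2 * (x + s) * U + 2 * U ^ 3 + e) <= k * C); [|lra].
  apply Rmult_le_compat_l; [lra|]. unfold C. lra. }
assert (Hclo : 1 - k * C <= c).
{ assert (k * (- C) <= k * (x + s - e)); [|lra].
  apply Rmult_le_compat_l; [lra|]. unfold C. lra. }
assert (Hhu : h * U <= 1 / 2).
{ apply Rle_trans with (2 := Hb4). apply Rmult_le_compat; lra. }
assert (Hhu0 : 0 < h * U) by (apply Rmult_lt_0_compat; lra).
assert (HkU : (h * U) ^ 2 = k * U ^ 2) by (unfold k; ring).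
assert (HU2 : 0 < U ^ 2) by nra.
split; [|split].
- set (D := 1 + de). intros HB.
  set (z := k * D ^ 2 * U ^ 2).
  assert (Hz : (D * h * U) ^ 2 = z) by (unfold z, k; ring).
  assert (Hz1 : z < 1).
  { rewrite <- Hz. assert (0 < D * h * U) by (unfold D; nra). nra. }
  assert (Hz0 : 0 < z) by (rewrite <- Hz; assert (0 < D * h * U) by (unfold D; nra); nra).
  rewrite Hz.
  apply Rle_trans with (c * (2 * (D * h * U)) * (1 + z)).
  + replace (D * h * u (x + h) + D * h * u (x - h)) with (D * h * S) by (unfold S; ring).
    replace (c * (2 * (D * h * U)) * (1 + z)) with (D * h * (2 * U * (c + c * z))) by ring.
    apply Rmult_le_compat_l; [unfold D; nra|].
    assert (Hcz : (1 - k * C) * z <= c * z) by (apply Rmult_le_compat_r; lra).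
    (* One of the two factors [1 + de] pays for [c] being possibly below [1]; the other remains as
       the gain. *)
    assert (Hgain : k * (1 + de) * U ^ 2 <= (1 - k * C) * z).
    { unfold z. replace ((1 - k * C) * (k * D ^ 2 * U ^ 2))
        with (k * ((1 - k * C) * D ^ 2) * U ^ 2) by ring.
      apply Rmult_le_compat_r; [lra|]. apply Rmult_le_compat_l; [lra|].
      apply Rle_trans with ((1 - de / 4) * D ^ 2); [unfold D; nra|].
      apply Rmult_le_compat_r; [apply pow2_ge_0|lra]. }
    assert (H1 : 1 + k * (x + s) - e * k + k * (1 + de) * U ^ 2 <= c + c * z) by lra.
    apply Rle_trans with (2 * U * (1 + k * (x + s) - e * k + k * (1 + de) * U ^ 2));
      [|apply Rmult_le_compat_l; lra].
    assert (H2 : k * (e * (1 + 2 * U)) <= k * (2 * U ^ 3 * de)).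
    { apply Rmult_le_compat_l; [lra|]. nra. }
    lra.
  + replace (c * (2 * (D * h * U) / (1 - z))) with (c * (2 * (D * h * U)) * (/ (1 - z)))
      by (field; lra).
    apply Rmult_le_compat_l.
    * apply Rmult_le_pos; [lra|]. unfold D; nra.
    * apply Rmult_le_reg_r with (1 - z); [lra|]. rewrite Rinv_l by lra. nra.
- nra.
- set (D := 1 - de).
  set (z := k * D ^ 2 * U ^ 2).
  assert (Hz : (D * h * U) ^ 2 = z) by (unfold z, k; ring).
  assert (HD : 0 < D * h * U < 1) by (unfold D; split; nra).
  assert (Hz1 : 0 < z < 1) by (rewrite <- Hz; split; nra).
  rewrite Hz.
  replace (D * h * u (x + h) + D * h * u (x - h)) with (D * h * S) by (unfold S; ring).
  replace (c * (2 * (D * h * U) / (1 - z))) with (D * h * (2 * U * c) / (1 - z)) by (field; lra).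
  (* The lower bound [1 + z] for [1 / (1 - z)] goes the wrong way for a subsolution, so the
     denominator is cleared and the product [S z] is estimated. *)
  apply Rmult_le_reg_r with (1 - z); [lra|].
  unfold Rdiv. rewrite Rmult_assoc, Rinv_l, Rmult_1_r by lra.
  rewrite (Rmult_assoc (D * h) S).
  apply Rmult_le_compat_l; [unfold D; nra|].
  assert (HSz : S * z <= (2 * U + k * C) * z) by (apply Rmult_le_compat_r; lra).
  assert (Hzle : z <= k * (1 - de) * U ^ 2).
  { unfold z. apply Rmult_le_compat_r; [lra|]. apply Rmult_le_compat_l; [lra|].
    unfold D; nra. }
  assert (HSz2 : (2 * U + k * C) * z <= (2 * U + mu * de) * (k * (1 - de) * U ^ 2)).
  { assert (0 < k * C) by now apply Rmult_lt_0_compat.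
    apply Rmult_le_compat; lra. }
  assert (Hfin : 2 * U * (1 + k * (x + s) + e * k)
     <= 2 * U + k * (2 * (x + s) * U + 2 * U ^ 3 - e) - (2 * U + mu * de) * (k * (1 - de) * U ^ 2)).
  { assert (H1 : k * (e * (1 + 2 * U)) <= k * (2 * U ^ 3 - (2 * U + mu * de) * ((1 - de) * U ^ 2))); [|lra].
    apply Rmult_le_compat_l; [lra|].
    apply Rle_trans with (1 := HeU).
    apply Rle_trans with (U ^ 3 * de); [apply Rmult_le_compat_r; lra|].
    assert (mu * de * ((1 - de) * U ^ 2) <= U * de * U ^ 2).
    { assert (0 < mu * de) by now apply Rmult_lt_0_compat.
      apply Rmult_le_compat; [lra| | |].
      - apply Rmult_le_pos; lra.
      - apply Rmult_le_compat_r; lra.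
      - rewrite <- (Rmult_1_l (U ^ 2)) at 2. apply Rmult_le_compat_r; lra. }
    lra. }
  assert (2 * U * c <= 2 * U * (1 + k * (x + s) + e * k)) by (apply Rmult_le_compat_l; lra).
  lra.
Qed.

(** * Barriers in scaled variables, with [N] the cube root of [n], and matching at the two ends *)

Lemma scaled_upper_bound (eps s kappa : R) : 0 < eps -> 0 < kappa ->
  exists N0, 1 <= N0 /\ forall (n : nat) (N : R) (a : Z -> R) (k : Z),
    N0 <= N -> N ^ 3 = INR n -> is_bvp_solution eps (N ^ 3 - s * N) n a ->
    (-1 <= k <= Z.of_nat n - 1)%Z ->
    N * a k <= N / (INR n - IZR k)
               + sqrt ((1 + kappa) * ((INR n - IZR k) / N + Rabs s)).
Proof.
intros Heps Hkap.
assert (Hs0 := Rabs_pos s). assert (Hs1 := Rle_abs s).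
assert (Hs2 := Rle_abs (- s)). rewrite Rabs_Ropp in Hs2.
assert (HK : 0 <= Rabs s * (1 + kappa) / kappa) by (apply Rdiv_le_0_compat; nra).
exists (1 + Rabs s * (1 + kappa) / kappa). split; [lra|].
intros n N a k HN Hn Ha Hk.
assert (HN2 : Rabs s * (1 + kappa) <= kappa * N ^ 2).
{ replace (Rabs s * (1 + kappa)) with (kappa * (Rabs s * (1 + kappa) / kappa)) by (field; lra).
  apply Rmult_le_compat_l; [lra|]. nra. }
set (t := N ^ 3 - s * N) in *.
assert (Ht : N ^ 3 <= (1 + kappa) * t).
{ assert (0 <= N * (kappa * N ^ 2 - Rabs s * (1 + kappa))) by (apply Rmult_le_pos; lra).
  assert (N * s * (1 + kappa) <= N * Rabs s * (1 + kappa)).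
  { apply Rmult_le_compat_r; [lra|]. apply Rmult_le_compat_l; lra. }
  unfold t. lra. }
assert (HN3 : 0 < N ^ 3) by (apply pow_lt; lra).
assert (Ht0 : 0 < t) by nra.
(* The shift [|s| N] covers the difference between [t] and [n]; [N^3 / t <= 1 + kappa] then accounts
   for the factor under the root. *)
assert (Hup := bvp_upper_barrier eps t (Rabs s * N) n a k Heps Ht0 ltac:(nra)
  ltac:(unfold t; rewrite <- Hn; nra) Ha Hk).
assert (Hj : 1 <= INR n - IZR k).
{ rewrite INR_IZR_INZ, <- minus_IZR. apply IZR_le; lia. }
set (j := INR n - IZR k) in *.
apply Rle_trans with (N * (/ j + sqrt ((j + Rabs s * N) / t))).
{ apply Rmult_le_compat_l; lra. }
rewrite Rmult_plus_distr_l. apply Rplus_le_compat_l.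
rewrite <- (sqrt_pow2 N) at 1 by lra.
rewrite <- sqrt_mult_alt by nra. apply sqrt_le_1_alt.
replace (N ^ 2 * ((j + Rabs s * N) / t)) with (N ^ 3 / t * (j / N + Rabs s)) by (field; lra).
apply Rmult_le_compat_r.
- assert (0 < j / N) by (apply Rdiv_lt_0_compat; lra). lra.
- apply Rmult_le_reg_r with t; [lra|]. unfold Rdiv.
  rewrite Rmult_assoc, Rinv_l; lra.
Qed.

Lemma scaled_lower_bound_near (eps s : R) : 0 < eps ->
  exists m N0, 0 < m /\ 1 <= N0 /\ forall (n : nat) (N : R) (a : Z -> R) (k : Z),
    N0 <= N -> N ^ 3 = INR n -> is_bvp_solution eps (N ^ 3 - s * N) n a ->
    (-1 <= k <= Z.of_nat n - 1)%Z ->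
    m / sinh (m * ((INR n - IZR k) / N)) <= N * a k.
Proof.
intros Heps.
assert (Hs0 := Rabs_pos s). assert (Hs1 := Rle_abs s).
assert (Hs2 := Rle_abs (- s)). rewrite Rabs_Ropp in Hs2.
(* Chosen so that [m^2 / 2 - s >= 1]: then [t cosh (m / N)] exceeds [n] by at least [N] up to a
   bounded term, which covers [eps]. *)
set (m := 2 * (Rabs s + 1)).
assert (Hm : 2 <= m) by (unfold m; lra).
exists m, (1 + eps + Rabs s * m ^ 2). split; [lra|].
assert (Hsm : 0 <= Rabs s * m ^ 2) by (apply Rmult_le_pos; [lra|apply pow2_ge_0]).
split; [lra|].
intros n N a k HN Hn Ha Hk.
set (t := N ^ 3 - s * N) in *.
assert (HsN : Rabs s <= Rabs s * m ^ 2).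
{ rewrite <- (Rmult_1_r (Rabs s)) at 1. apply Rmult_le_compat_l; nra. }
assert (HNs : s < N ^ 2).
{ apply Rlt_le_trans with (N * 1); [lra|].
  replace (N ^ 2) with (N * N) by ring. apply Rmult_le_compat_l; lra. }
assert (Ht0 : 0 < t).
{ unfold t. replace (N ^ 3 - s * N) with (N * (N ^ 2 - s)) by ring.
  apply Rmult_lt_0_compat; lra. }
assert (Hb : 0 < m / N) by (apply Rdiv_lt_0_compat; lra).
assert (Hcosh : INR n + eps <= t * cosh (m / N)).
{ apply Rle_trans with (t * (1 + (m / N) ^ 2 / 2)).
  - rewrite <- Hn. unfold t.
    replace ((N ^ 3 - s * N) * (1 + (m / N) ^ 2 / 2))
      with (N ^ 3 + N * (m ^ 2 / 2 - s) - s * m ^ 2 / (2 * N)) by (field; lra).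
    assert (N * 1 <= N * (m ^ 2 / 2 - s)).
    { apply Rmult_le_compat_l; [lra|]. unfold m; nra. }
    assert (s * m ^ 2 / (2 * N) <= Rabs s * m ^ 2); [|lra].
    apply Rmult_le_reg_r with (2 * N); [lra|]. unfold Rdiv.
    rewrite Rmult_assoc, Rinv_l, Rmult_1_r by lra.
    assert (s * m ^ 2 <= Rabs s * m ^ 2) by (apply Rmult_le_compat_r; nra).
    nra.
  - apply Rmult_le_compat_l; [lra|]. now apply cosh_ge_quadratic. }
assert (Hlo := bvp_lower_barrier eps t (m / N) n a k Heps Ht0 Hb Hcosh Ha Hk).
assert (Hj : 1 <= INR n - IZR k).
{ rewrite INR_IZR_INZ, <- minus_IZR. apply IZR_le; lia. }
set (j := INR n - IZR k) in *.
replace (m / N * j) with (m * (j / N)) in Hlo by (field; lra).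
apply Rle_trans with (N * (sinh (m / N) / sinh (m * (j / N)))).
- assert (HS : 0 < sinh (m * (j / N))).
  { apply sinh_pos, Rmult_lt_0_compat; [lra|]. apply Rdiv_lt_0_compat; lra. }
  assert (Hsi := sinh_ge_id _ Hb).
  replace (N * (sinh (m / N) / sinh (m * (j / N))))
    with (N * sinh (m / N) / sinh (m * (j / N))) by (field; lra).
  apply Rmult_le_compat_r; [left; now apply Rinv_0_lt_compat|].
  apply Rle_trans with (N * (m / N)); [right; field; lra|].
  apply Rmult_le_compat_l; lra.
- apply Rmult_le_compat_l; lra.
Qed.

Lemma up_bounds (r : R) : r < IZR (up r) <= r + 1.
Proof. destruct (archimed r). lra. Qed.

(* A cosine arch of length about [4 N] centred at [k] costs only the additive
   constant [5] below the equilibrium [sqrt (X - s)]. *)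
Lemma scaled_lower_bound_far (eps s L : R) : 0 < eps -> 0 < L ->
  exists N0, 1 <= N0 /\ forall (n : nat) (N : R) (a : Z -> R) (k : Z),
    N0 <= N -> N ^ 3 = INR n -> is_bvp_solution eps (N ^ 3 - s * N) n a ->
    Rabs s + 5 < (INR n - IZR k) / N <= L ->
    sqrt ((INR n - IZR k) / N - Rabs s - 5) <= N * a k.
Proof.
intros Heps HL.
assert (Hs0 := Rabs_pos s). assert (Hs1 := Rle_abs s).
assert (Hs2 := Rle_abs (- s)). rewrite Rabs_Ropp in Hs2.
exists (3 + eps + L + Rabs s * (L + 1)).
assert (HsL : 0 <= Rabs s * (L + 1)) by (apply Rmult_le_pos; lra).
split; [lra|].
intros n N a k HN Hn Ha HX.
set (t := N ^ 3 - s * N) in *.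
set (X := (INR n - IZR k) / N) in *.
assert (Hk : IZR k = N ^ 3 - X * N) by (unfold X; rewrite Hn; field; lra).
assert (HNs : Rabs s < N ^ 2) by nra.
assert (Ht0 : 0 < t).
{ unfold t. replace (N ^ 3 - s * N) with (N * (N ^ 2 - s)) by ring.
  apply Rmult_lt_0_compat; lra. }
set (r := sqrt (X - Rabs s - 5)).
assert (Hr0 : 0 < r) by (apply sqrt_lt_R0; lra).
assert (Hrr : r * r = X - Rabs s - 5) by (apply sqrt_sqrt; lra).
assert (HrN : r < N).
{ apply Rsqr_incrst_0; [unfold Rsqr; nra|lra|lra]. }
(* With [w = 1 / N] the half-length [l] has phase between [2] and [5/2], inside the range where the
   cosine is nonpositive, even with the coarse bounds [2 < PI <= 4]. *)
assert (Hup := up_bounds (2 * N)).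
set (l := up (2 * N)) in *.
assert (Hin1 : 0 < / N) by (apply Rinv_0_lt_compat; lra).
assert (Hin2 : / N <= 1 / 2).
{ apply Rle_trans with (/ 2); [apply Rinv_le_contravar; lra|lra]. }
assert (HNN : / N * N = 1) by (field; lra).
assert (Hl1 : 2 < / N * IZR l) by nra.
assert (Hl2 : / N * IZR l <= 5 / 2) by nra.
assert (HPI1 := PI_4). assert (HPI2 := PI2_1).
assert (HkX : IZR k + 5 * N <= N ^ 3) by nra.
assert (Hmain : r / N <= a k).
{ apply (bvp_bump eps t (r / N) (/ N) n a k l); try assumption.
  - split; [apply Rdiv_lt_0_compat; lra|].
    apply Rmult_lt_reg_r with N; [lra|]. unfold Rdiv. rewrite Rmult_assoc, Rinv_l; lra.
  - nra.
  - apply lt_IZR. lra.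
  - split; lra.
  - apply le_IZR. rewrite minus_IZR, Hk.
    assert (N * (L + 3) <= N * N ^ 2) by (apply Rmult_le_compat_l; nra).
    assert (X * N <= L * N) by (apply Rmult_le_compat_r; lra). lra.
  - apply le_IZR. rewrite plus_IZR, minus_IZR, <- INR_IZR_INZ, <- Hn. lra.
  - apply Rmult_le_reg_r with t; [lra|].
    unfold Rdiv at 1. rewrite Rmult_assoc, Rinv_l, Rmult_1_r by lra.
    (* The [1/2] comes from [w^2 / 2]. The half-length [l] costs about [2 N], so the constant [5]
       leaves [5/2 N] to absorb all bounded terms. *)
    set (D := X - Rabs s - 5 + 1 / 2).
    apply Rle_trans with ((1 - D / N ^ 2) * t).
    + unfold t. replace ((1 - D / N ^ 2) * (N ^ 3 - s * N))
        with (N ^ 3 - (s + D) * N + s * D / N) by (field; lra).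
      assert (HsD : - (Rabs s * (L + 1)) <= s * D / N).
      { assert (Rabs (s * D) <= Rabs s * (L + 1)).
        { rewrite Rabs_mult. apply Rmult_le_compat_l; [lra|].
          apply Rabs_le. unfold D; lra. }
        assert (Hle := Rle_abs (- (s * D))). rewrite Rabs_Ropp in Hle.
        unfold Rdiv. nra. }
      assert (s * N <= Rabs s * N) by (apply Rmult_le_compat_r; lra).
      rewrite Hk. unfold D in *. lra.
    + apply Rmult_le_compat_r; [lra|].
      replace ((r / N) ^ 2) with ((r * r) / N ^ 2) by (field; lra). rewrite Hrr.
      unfold D.
      replace ((1 - (/ N) ^ 2 / 2) * (1 - (X - Rabs s - 5) / N ^ 2))
        with (1 - (X - Rabs s - 5 + 1 / 2) / N ^ 2
              + (X - Rabs s - 5) * / N ^ 2 * ((/ N) ^ 2 / 2)) by (field; lra).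
      assert (0 <= (X - Rabs s - 5) * / N ^ 2 * ((/ N) ^ 2 / 2)); [|lra].
      apply Rmult_le_pos; [|nra]. apply Rmult_le_pos; [lra|].
      left. apply Rinv_0_lt_compat. nra. }
apply Rle_trans with (N * (r / N)); [right; field; lra|].
apply Rmult_le_compat_l; lra.
Qed.

Lemma sinh_near_zero (e : R) : 0 < e ->
  exists d, 0 < d /\ forall z, 0 < z < d -> sinh z <= (1 + e) * z.
Proof.
intros He.
destruct (derivable_pt_lim_sinh 0 e He) as [d Hd].
exists d. split; [apply cond_pos|]. intros z Hz.
assert (H := Hd z ltac:(lra) ltac:(apply Rabs_def1; lra)).
rewrite Rplus_0_l, sinh_0, cosh_0, Rminus_0_r in H. apply Rabs_def2 in H.
assert (E : sinh z = sinh z / z * z) by (field; lra).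
rewrite E. apply Rmult_le_compat_r; lra.
Qed.

(** Multiplied by [X], the barriers and the profile all tend to [1] at [X = 0]. The tolerances fit
    because [(1 - de) (1 + de) (1 + de^2) = 1 - de^4] and [(1 + de) (1 - de / 4) >= 1 + de / 2]. *)
Lemma profile_bounds_near (u : R -> R) (sa m de : R) :
  0 <= sa -> 0 < m -> 0 < de < 1 ->
  (forall d, 0 < d -> exists eta, 0 < eta /\ forall X, 0 < X < eta ->
     1 - d <= X * u (- X) <= 1 + d) ->
  exists eta, 0 < eta /\ forall X, 0 < X < eta ->
    / X + sqrt (2 * (X + sa)) <= (1 + de) * u (- X) /\
    (1 - de) * u (- X) <= m / sinh (m * X).
Proof.
intros Hsa Hm Hde Hu.
destruct (Hu (de / 4)) as [e1 [He1 H1]]; [lra|].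
destruct (Hu de) as [e2 [He2 H2]]; [lra|].
destruct (sinh_near_zero (de ^ 2)) as [d [Hd H3]]; [nra|].
set (B := 2 * sqrt (2 * (1 + sa)) / de).
assert (Hsq : 0 < sqrt (2 * (1 + sa))) by (apply sqrt_lt_R0; lra).
assert (HB : 0 < B) by (unfold B; apply Rdiv_lt_0_compat; lra).
exists (Rmin (Rmin e1 e2) (Rmin (d / m) (Rmin 1 (/ B)))).
assert (Hdm : 0 < d / m) by now apply Rdiv_lt_0_compat.
assert (HB' : 0 < / B) by now apply Rinv_0_lt_compat.
split; [repeat apply Rmin_pos; lra|].
intros X HX.
assert (M1 := Rmin_l (Rmin e1 e2) (Rmin (d / m) (Rmin 1 (/ B)))).
assert (M2 := Rmin_r (Rmin e1 e2) (Rmin (d / m) (Rmin 1 (/ B)))).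
assert (M3 := Rmin_l e1 e2). assert (M4 := Rmin_r e1 e2).
assert (M5 := Rmin_l (d / m) (Rmin 1 (/ B))). assert (M6 := Rmin_r (d / m) (Rmin 1 (/ B))).
assert (M7 := Rmin_l 1 (/ B)). assert (M8 := Rmin_r 1 (/ B)).
specialize (H1 X ltac:(lra)). specialize (H2 X ltac:(lra)).
assert (HmX : m * X < d).
{ apply Rlt_le_trans with (m * (d / m)); [apply Rmult_lt_compat_l; lra|right; field; lra]. }
assert (HmX0 : 0 < m * X) by (apply Rmult_lt_0_compat; lra).
specialize (H3 (m * X) (conj HmX0 HmX)).
split.
- apply Rmult_le_reg_l with X; [lra|].
  replace (X * (/ X + sqrt (2 * (X + sa)))) with (1 + X * sqrt (2 * (X + sa))) by (field; lra).
  assert (Hs : sqrt (2 * (X + sa)) <= sqrt (2 * (1 + sa))) by (apply sqrt_le_1_alt; lra).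
  assert (HXs : X * sqrt (2 * (X + sa)) <= de / 2).
  { apply Rle_trans with (/ B * sqrt (2 * (1 + sa))).
    - apply Rmult_le_compat; [lra|apply sqrt_pos|lra|exact Hs].
    - unfold B. right. field. lra. }
  replace (X * ((1 + de) * u (- X))) with ((1 + de) * (X * u (- X))) by ring.
  assert ((1 + de) * (1 - de / 4) <= (1 + de) * (X * u (- X)))
    by (apply Rmult_le_compat_l; lra).
  nra.
- assert (HS := sinh_pos _ HmX0).
  apply Rmult_le_reg_r with (sinh (m * X)); [exact HS|].
  replace (m / sinh (m * X) * sinh (m * X)) with m by (field; lra).
  assert (Hu0 : 0 < u (- X)) by (apply Rmult_lt_reg_l with X; lra).
  apply Rle_trans with ((1 - de) * u (- X) * ((1 + de ^ 2) * (m * X))).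
  + apply Rmult_le_compat_l; [|exact H3]. apply Rmult_le_pos; lra.
  + replace ((1 - de) * u (- X) * ((1 + de ^ 2) * (m * X)))
      with (m * ((1 - de) * (1 + de ^ 2) * (X * u (- X)))) by ring.
    rewrite <- (Rmult_1_r m) at 2. apply Rmult_le_compat_l; [lra|].
    apply Rle_trans with ((1 - de) * (1 + de ^ 2) * (1 + de)).
    * apply Rmult_le_compat_l; [|lra]. apply Rmult_le_pos; nra.
    * replace ((1 - de) * (1 + de ^ 2) * (1 + de)) with (1 - de ^ 2 * de ^ 2) by ring. nra.
Qed.

Lemma profile_bounds_far (u : R -> R) (sa de : R) :
  0 <= sa -> 0 < de < 1 ->
  (forall d, 0 < d -> exists L, forall X, L < X -> 0 < X ->
     (1 - d) * sqrt X <= u (- X) <= (1 + d) * sqrt X) ->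
  exists L, 0 < L /\ forall X, L < X -> sa + 5 < X /\
    / X + sqrt ((1 + de / 4) * (X + sa)) <= (1 + de) * u (- X) /\
    (1 - de) * u (- X) <= sqrt (X - sa - 5).
Proof.
intros Hsa Hde Hu.
destruct (Hu (de / 8)) as [L1 H1]; [lra|].
destruct (Hu (de / 2)) as [L2 H2]; [lra|].
(* Beyond [L], [de X] exceeds [8], making [1 / X] at most [de / 8], exceeds [4 sa], absorbing the
   shift in the upper bound, and dominates [sa + 5] in the lower one. *)
set (L := Rmax (Rmax L1 L2) ((8 + 4 * sa + 10) / de)).
assert (M1 := Rmax_l (Rmax L1 L2) ((8 + 4 * sa + 10) / de)).
assert (M2 := Rmax_r (Rmax L1 L2) ((8 + 4 * sa + 10) / de)).
assert (M3 := Rmax_l L1 L2). assert (M4 := Rmax_r L1 L2).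
fold L in M1, M2.
assert (HK : 0 < (8 + 4 * sa + 10) / de) by (apply Rdiv_lt_0_compat; lra).
exists L. split; [lra|]. intros X HX.
assert (HdX : 8 + 4 * sa + 10 < de * X).
{ replace (8 + 4 * sa + 10) with (de * ((8 + 4 * sa + 10) / de)) by (field; lra).
  apply Rmult_lt_compat_l; lra. }
assert (HX18 : 18 < X) by nra.
specialize (H1 X ltac:(lra) ltac:(lra)). specialize (H2 X ltac:(lra) ltac:(lra)).
assert (HS1 : 1 <= sqrt X) by (rewrite <- sqrt_1; apply sqrt_le_1_alt; lra).
assert (HSS : sqrt X * sqrt X = X) by (apply sqrt_sqrt; lra).
set (S := sqrt X) in *.
split; [nra|]. split.
- assert (Hi : / X <= de / 8 * S).
  { apply Rle_trans with (de / 8); [|nra].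
    apply Rmult_le_reg_r with X; [lra|]. rewrite Rinv_l; lra. }
  assert (Hq : sqrt ((1 + de / 4) * (X + sa)) <= (1 + de / 4) * S).
  { rewrite <- (sqrt_pow2 ((1 + de / 4) * S)) by nra. apply sqrt_le_1_alt.
    replace (((1 + de / 4) * S) ^ 2) with ((1 + de / 4) * ((1 + de / 4) * (S * S))) by ring.
    rewrite HSS. apply Rmult_le_compat_l; lra. }
  assert ((1 + de) * ((1 - de / 8) * S) <= (1 + de) * u (- X))
    by (apply Rmult_le_compat_l; lra).
  assert ((1 + de / 4 + de / 8) * S <= (1 + de) * (1 - de / 8) * S)
    by (apply Rmult_le_compat_r; nra).
  lra.
- apply Rle_trans with ((1 - de / 2) * S).
  + apply Rle_trans with ((1 - de) * ((1 + de / 2) * S)).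
    * apply Rmult_le_compat_l; lra.
    * rewrite <- Rmult_assoc. apply Rmult_le_compat_r; nra.
  + rewrite <- (sqrt_pow2 ((1 - de / 2) * S)) by nra. apply sqrt_le_1_alt.
    replace (((1 - de / 2) * S) ^ 2) with ((1 - de / 2) * ((1 - de / 2) * (S * S))) by ring.
    rewrite HSS. nra.
Qed.

Lemma scaled_sandwich (u u1 : R -> R) (eps s A B de : R) :
  0 < eps -> 0 < A < B -> 0 < de < 1 ->
  (forall z, z < 0 -> is_derive u z (u1 z) /\
     is_derive u1 z (2 * (z + s) * u z + 2 * u z ^ 3) /\ 0 < u z) ->
  (forall d, 0 < d -> exists eta, 0 < eta /\ forall X, 0 < X < eta ->
     1 - d <= X * u (- X) <= 1 + d) ->
  (forall d, 0 < d -> exists L, forall X, L < X -> 0 < X ->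
     (1 - d) * sqrt X <= u (- X) <= (1 + d) * sqrt X) ->
  exists N0, 1 <= N0 /\ forall (n : nat) (N : R) (a : Z -> R) (k : Z),
    N0 <= N -> N ^ 3 = INR n -> is_bvp_solution eps (N ^ 3 - s * N) n a ->
    A <= (INR n - IZR k) / N <= B ->
    (1 - de) * u (- ((INR n - IZR k) / N)) <= N * a k
    <= (1 + de) * u (- ((INR n - IZR k) / N)).
Proof.
intros Heps HAB Hde Hu Hnear Hfar.
assert (Hs0 := Rabs_pos s). assert (Hs1 := Rle_abs s).
assert (Hs2 := Rle_abs (- s)). rewrite Rabs_Ropp in Hs2.
destruct (scaled_upper_bound eps s 1 Heps ltac:(lra)) as [N1 [HN1 Hup1]].
destruct (scaled_upper_bound eps s (de / 4) Heps ltac:(lra)) as [N2 [HN2 Hup2]].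
destruct (scaled_lower_bound_near eps s Heps) as [m [N3 [Hm [HN3 Hlo1]]]].
destruct (profile_bounds_near u (Rabs s) m de Hs0 Hm Hde Hnear) as [eta0 [Heta0 Hb1]].
destruct (profile_bounds_far u (Rabs s) de Hs0 Hde Hfar) as [L0 [HL0 Hb2]].
(* The halves leave room for rounding: the grid point next to [eta] lies below [2 eta], hence below
   [eta0] and [A]. Likewise [L + 1] below allows for the grid point past [L]. *)
set (eta := Rmin (eta0 / 2) (A / 2)).
assert (He1 : eta <= eta0 / 2) by apply Rmin_l.
assert (He2 : eta <= A / 2) by apply Rmin_r.
assert (He0 : 0 < eta) by (apply Rmin_pos; lra).
set (L := Rmax L0 B).
assert (HL1 : L0 <= L) by apply Rmax_l.
assert (HL2 : B <= L) by apply Rmax_r.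
destruct (scaled_lower_bound_far eps s (L + 1) Heps ltac:(lra)) as [N4 [HN4 Hlo2]].
destruct (recurrence_strict_perturbation u u1 s (L + 1) eta de ltac:(lra) Hde Hu)
  as [h0 [e [Hh0 [He Hpert]]]].
(* The coefficient differs from [1 + h^2 (x + s)] by at most [C / t], of order [h^3]; [N >= 2 C / e]
   brings this under [e h^2]. *)
set (C := eps + Rabs s * (L + 1 + Rabs s)).
assert (HC : 0 < C).
{ unfold C. assert (0 <= Rabs s * (L + 1 + Rabs s)) by (apply Rmult_le_pos; lra). lra. }
assert (HCe : 0 < 2 * C / e) by (apply Rdiv_lt_0_compat; lra).
assert (Hih : 0 < / h0) by now apply Rinv_0_lt_compat.
assert (Hie : 0 < / eta) by now apply Rinv_0_lt_compat.
exists (N1 + N2 + N3 + N4 + (1 + / h0) + (1 + / eta) + 2 * C / e + 2 * Rabs s + L + 1).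
split; [lra|].
intros n N a k HN Hn Ha HX.
set (t := N ^ 3 - s * N) in *.
assert (HN0 : 1 < N) by lra.
assert (HNN : N <= N ^ 2) by nra.
assert (Ht : N ^ 3 / 2 <= t).
{ unfold t. assert (0 <= N * (N ^ 2 / 2 - s)); [|lra].
  apply Rmult_le_pos; lra. }
assert (HN3p : 0 < N ^ 3) by (apply pow_lt; lra).
set (h := / N).
assert (Hh : 0 < h) by (apply Rinv_0_lt_compat; lra).
assert (HhN : h * N = 1) by (unfold h; field; lra).
assert (Hh1 : h <= 1) by (rewrite <- Rinv_1; apply Rinv_le_contravar; lra).
assert (Hhh0 : h < h0).
{ rewrite <- (Rinv_inv h0). apply Rinv_lt_contravar; [|lra]. apply Rmult_lt_0_compat; lra. }
assert (Hheta : h < eta).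
{ rewrite <- (Rinv_inv eta). apply Rinv_lt_contravar; [|lra]. apply Rmult_lt_0_compat; lra. }
set (X := fun k : Z => (INR n - IZR k) / N).
fold (X k) in HX |- *.
assert (HXh : forall j, X j = (INR n - IZR j) * h) by (intros j; reflexivity).
assert (Hupq := up_bounds (eta * N)). assert (Hupp := up_bounds (L * N)).
(* The index falls as the distance [X] grows, so the left index [p] belongs to [L] and the right
   index [q] to [eta]. *)
set (q := (Z.of_nat n - up (eta * N))%Z). set (p := (Z.of_nat n - up (L * N))%Z).
assert (HXq : eta < X q <= eta + h).
{ rewrite HXh. unfold q. rewrite minus_IZR, <- INR_IZR_INZ.
  replace (INR n - (INR n - IZR (up (eta * N)))) with (IZR (up (eta * N))) by ring.
  split.
  - replace eta with (eta * N * h) at 1 by (rewrite Rmult_assoc, (Rmult_comm N); rewrite HhN; ring).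
    apply Rmult_lt_compat_r; lra.
  - apply Rle_trans with ((eta * N + 1) * h); [apply Rmult_le_compat_r; lra|].
    right. replace ((eta * N + 1) * h) with (eta * (h * N) + h) by ring. rewrite HhN. ring. }
assert (HXp : L < X p <= L + h).
{ rewrite HXh. unfold p. rewrite minus_IZR, <- INR_IZR_INZ.
  replace (INR n - (INR n - IZR (up (L * N)))) with (IZR (up (L * N))) by ring.
  split.
  - replace L with (L * N * h) at 1 by (rewrite Rmult_assoc, (Rmult_comm N); rewrite HhN; ring).
    apply Rmult_lt_compat_r; lra.
  - apply Rle_trans with ((L * N + 1) * h); [apply Rmult_le_compat_r; lra|].
    right. replace ((L * N + 1) * h) with (L * (h * N) + h) by ring. rewrite HhN. ring. }
assert (HXmono : forall i j, (i <= j)%Z -> X j <= X i).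
{ intros i j Hij. apply IZR_le in Hij. rewrite !HXh. apply Rmult_le_compat_r; lra. }
assert (HXmono' : forall i j, X j < X i -> (i < j)%Z).
{ intros i j Hij. apply Z.nle_gt. intros Hle. specialize (HXmono j i Hle). lra. }
assert (Hpk : (p < k)%Z) by (apply HXmono'; lra).
assert (Hkq : (k < q)%Z) by (apply HXmono'; lra).
assert (Hq : (q <= Z.of_nat n - 1)%Z).
{ unfold q. assert (0 < up (eta * N))%Z; [|lia]. apply lt_IZR.
  assert (0 < eta * N) by (apply Rmult_lt_0_compat; lra). lra. }
assert (Hp : (-1 <= p)%Z).
{ unfold p. apply le_IZR. rewrite minus_IZR, <- INR_IZR_INZ, <- Hn.
  assert (N * (L + 1) <= N * N ^ 2) by (apply Rmult_le_compat_l; lra).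
  replace (N ^ 3) with (N * N ^ 2) by ring. lra. }
assert (Hxs : forall j, - X (j + 1)%Z = - X j + h /\ - X (j - 1)%Z = - X j - h).
{ intros j. rewrite !HXh, plus_IZR, minus_IZR. split; ring. }
assert (HXin : forall j, (p <= j <= q)%Z -> eta < X j <= L + 1).
{ intros j Hj. assert (HA := HXmono p j ltac:(lia)). assert (HB := HXmono j q ltac:(lia)). lra. }
assert (Hcoef : forall j, (p <= j <= q)%Z ->
  Rabs ((IZR j + eps) / t - 1 - h ^ 2 * (- X j + s)) <= e * h ^ 2).
{ intros j Hj. specialize (HXin j Hj).
  assert (Hj' : IZR j = N ^ 3 - X j * N) by (unfold X; rewrite Hn; field; lra).
  replace ((IZR j + eps) / t - 1 - h ^ 2 * (- X j + s))
    with ((eps + s * (- X j + s) * h) / t).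
  2:{ assert (N ^ 3 - s * N <> 0) by (fold t; lra).
      clear - Hj' H HN0. rewrite Hj'. unfold h, t. field. split; lra. }
  unfold Rdiv. rewrite Rabs_mult, Rabs_inv, (Rabs_pos_eq t) by lra.
  apply Rmult_le_reg_r with t; [lra|]. rewrite Rmult_assoc, Rinv_l, Rmult_1_r by lra.
  apply Rle_trans with C.
  - apply Rle_trans with (1 := Rabs_triang _ _). rewrite (Rabs_pos_eq eps) by lra.
    unfold C. apply Rplus_le_compat_l. rewrite !Rabs_mult, Rmult_assoc.
    apply Rmult_le_compat_l; [lra|]. rewrite (Rabs_pos_eq h) by lra.
    assert (Rabs (- X j + s) <= L + 1 + Rabs s) by (apply Rabs_le; lra).
    assert (0 <= Rabs (- X j + s)) by apply Rabs_pos. nra.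
  - apply Rle_trans with (e * h ^ 2 * (N ^ 3 / 2)).
    + replace (e * h ^ 2 * (N ^ 3 / 2)) with (e * N / 2 * (h * N) ^ 2) by field.
      rewrite HhN. assert (e * (2 * C / e) <= e * N) by (apply Rmult_le_compat_l; lra).
      replace (e * (2 * C / e)) with (2 * C) in H by (field; lra). lra.
    + apply Rmult_le_compat_l; [|exact Ht]. assert (0 < h ^ 2) by nra. nra. }
assert (Hcpos : forall j, (p < j < q)%Z -> 0 < (IZR j + eps) / t).
{ intros j Hj. apply Rdiv_lt_0_compat; [|lra].
  assert (0 <= IZR j) by (apply IZR_le; lia). lra. }
assert (Hpos := fun j => bvp_solution_pos eps t n a j Ha).
assert (Hup1' := Hup1 n N a q ltac:(lra) Hn Ha ltac:(lia)).
assert (Hup2' := Hup2 n N a p ltac:(lra) Hn Ha ltac:(lia)).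
assert (Hlo1' := Hlo1 n N a q ltac:(lra) Hn Ha ltac:(lia)).
assert (Hlo2' := Hlo2 n N a p ltac:(lra) Hn Ha).
fold (X q) in Hup1', Hlo1'. fold (X p) in Hup2', Hlo2'.
assert (HinvX : forall j, 0 < X j -> N / (INR n - IZR j) = / X j).
{ intros j Hj. unfold X. field. split; [lra|].
  intros E. rewrite HXh, E in Hj. lra. }
rewrite HinvX in Hup1', Hup2' by lra.
destruct (Hb1 (X q) ltac:(lra)) as [Hb1u Hb1l].
destruct (Hb2 (X p) ltac:(lra)) as [Hb20 [Hb2u Hb2l]].
specialize (Hlo2' ltac:(lra)).
replace (1 + 1) with 2 in Hup1' by ring.
assert (Hscale : forall D v w, N * v <= D * w -> v <= D * h * w).
{ intros D v w Hv. apply Rmult_le_reg_l with N; [lra|].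
  replace (N * (D * h * w)) with (D * w * (h * N)) by ring. rewrite HhN. lra. }
assert (Hscale' : forall D v w, D * w <= N * v -> D * h * w <= v).
{ intros D v w Hv. apply Rmult_le_reg_l with N; [lra|].
  replace (N * (D * h * w)) with (D * w * (h * N)) by ring. rewrite HhN. lra. }
assert (Hrec : forall j, (p < j < q)%Z ->
  a (j + 1)%Z + a (j - 1)%Z = (IZR j + eps) / t * (2 * a j / (1 - a j ^ 2)) /\ a j < 1).
{ intros j Hj. destruct Ha as [H1 [_ [_ H2]]]. split; [apply H2; lia|apply H1; lia]. }
assert (Hupper : a k <= (1 + de) * h * u (- X k)).
{ apply (discrete_comparison (fun j => (IZR j + eps) / t) a
    (fun j => (1 + de) * h * u (- X j)) p q).
  - intros j Hj. specialize (HXin j Hj).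
    assert (0 < u (- X j)) by (apply Hu; lra).
    repeat apply Rmult_lt_0_compat; lra.
  - apply Hscale. lra.
  - apply Hscale. lra.
  - exact Hcpos.
  - intros j Hj _. destruct (Hrec j Hj) as [E Hlt]. split; [exact Hlt|]. rewrite E. lra.
  - intros j Hj Hlt. destruct (Hrec j Hj) as [_ Hlt1].
    destruct (Hxs j) as [-> ->]. assert (HXj := HXin j ltac:(lia)).
    apply (Hpert h (- X j) _ ltac:(lra) ltac:(lra) (Hcoef j ltac:(lia))). lra.
  - lia. }
assert (Hlower : (1 - de) * h * u (- X k) <= a k).
{ apply (discrete_comparison (fun j => (IZR j + eps) / t)
    (fun j => (1 - de) * h * u (- X j)) a p q).
  - intros j Hj. apply Hpos; lia.
  - apply Hscale'. lra.
  - apply Hscale'. lra.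
  - exact Hcpos.
  - intros j Hj _.
    destruct (Hxs j) as [-> ->]. assert (HXj := HXin j ltac:(lia)).
    apply (Hpert h (- X j) _ ltac:(lra) ltac:(lra) (Hcoef j ltac:(lia))).
  - intros j Hj _. destruct (Hrec j Hj) as [E _]. rewrite E. lra.
  - lia. }
split.
- apply Rmult_le_reg_l with h; [lra|].
  rewrite <- (Rmult_assoc h N), HhN, Rmult_1_l. lra.
- apply Rmult_le_reg_l with h; [lra|].
  rewrite <- (Rmult_assoc h N), HhN, Rmult_1_l. lra.
Qed.

(** * The Hastings-McLeod solution and its perturbations *)

Lemma eq_one_plus_o_bound (F : (R -> Prop) -> Prop) (FF : Filter F) (f g : R -> R) (d : R) :
  eq_one_plus_o F f g -> 0 < d ->
  F (fun x => exists r, - d < r < d /\ f x = g x * (1 + r)).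
Proof.
intros [e [He Hf]] Hd.
assert (Hs : F (fun x => Rabs (e x) < d)).
{ apply (He (fun z => Rabs z < d)). exists (mkposreal d Hd). intros z Hz.
  unfold ball, minus, plus, opp in Hz; simpl in Hz.
  unfold AbsRing_ball, abs, minus, plus, opp in Hz; simpl in Hz.
  now rewrite Ropp_0, Rplus_0_r in Hz. }
generalize (filter_and _ _ Hf Hs). apply filter_imp.
intros x [H1 H2]. exists (e x). split; [apply Rabs_def2 in H2; lra|exact H1].
Qed.

Lemma sqrt_gt (K x : R) : 0 < K -> x < - 2 * K ^ 2 -> K < sqrt (- x / 2).
Proof.
intros HK Hx. rewrite <- (sqrt_pow2 K) by lra. apply sqrt_lt_1_alt. split; nra.
Qed.

Lemma Hastings_McLeod_positive (y0 : R -> R) : is_Hastings_McLeod y0 ->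
  (forall x, PII_ode_at y0 (Derive y0) x) /\ forall x, 0 < y0 x.
Proof.
intros [Hsol [Han [Hm Hp]]].
assert (Hode : forall x, PII_ode_at y0 (Derive y0) x).
{ intros x. apply PII_solution_ode; [exact Hsol|]. apply analytic_at_not_pole, Han. }
split; [exact Hode|].
apply (PII_positive y0 (Derive y0) Hode).
- apply is_lim_spec. intros [d Hd]. simpl.
  destruct (eq_one_plus_o_bound _ _ _ _ (Rmin 1 (d / 3)) Hm) as [M HM].
  { apply Rmin_pos; lra. }
  assert (R1 := Rmin_l 1 (d / 3)). assert (R2 := Rmin_r 1 (d / 3)).
  exists (Rmin M 0). intros x Hx.
  assert (M1 := Rmin_l M 0). assert (M2 := Rmin_r M 0).
  destruct (HM x ltac:(lra)) as [r [Hr E]]. rewrite E.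
  replace (sqrt (- x / 2) * (1 + r) * (sqrt (- x / 2) * (1 + r) * 1))
    with (sqrt (- x / 2) * sqrt (- x / 2) * (1 + r) ^ 2) by ring.
  rewrite sqrt_sqrt by lra.
  replace (- x / 2 * (1 + r) ^ 2 / - x - 1 / 2) with (r + r ^ 2 / 2) by (field; lra).
  apply Rabs_def1; nra.
- destruct (eq_one_plus_o_bound _ _ _ _ (1 / 2) Hm) as [M HM]; [lra|].
  exists (Rmin M 0). intros x Hx.
  assert (M1 := Rmin_l M 0). assert (M2 := Rmin_r M 0).
  destruct (HM x ltac:(lra)) as [r [Hr ->]].
  assert (0 < sqrt (- x / 2)) by (apply sqrt_lt_R0; lra). nra.
- intros c Hc.
  destruct (eq_one_plus_o_bound _ _ _ _ 1 Hp) as [M HM]; [lra|].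
  exists (Rmax M (1 + 6 / c)). intros x Hx.
  assert (M1 := Rmax_l M (1 + 6 / c)). assert (M2 := Rmax_r M (1 + 6 / c)).
  assert (Hc6 : 0 < 6 / c) by (apply Rdiv_lt_0_compat; lra).
  destruct (HM x ltac:(lra)) as [r [Hr ->]].
  assert (HA := Ai_bound x ltac:(lra)).
  assert (HA' : Rabs (Ai x) < c / 2).
  { apply Rle_lt_trans with (1 := HA).
    assert (HPI := PI2_1). apply Rle_lt_trans with (3 / x).
    - apply Rmult_le_reg_r with PI; [lra|]. unfold Rdiv at 1.
      rewrite Rmult_assoc, Rinv_l by lra.
      assert (0 < 3 / x) by (apply Rdiv_lt_0_compat; lra). nra.
    - apply Rmult_lt_reg_r with x; [lra|]. unfold Rdiv at 1.
      rewrite Rmult_assoc, Rinv_l by lra.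
      assert (E : c * (6 / c) = 6) by (field; lra). nra. }
  apply Rabs_def2 in HA'. nra.
Qed.

(** The exponentially small term enters through its sign and the crude bound [b], which is
    negligible against [sqrt (- x / 2)]. *)
Lemma PII_family_growth (y0 : R -> R) (b : R) (y : R -> R) (d : R) :
  is_Hastings_McLeod y0 -> 0 < b -> is_PII_family y0 b y -> 0 < d ->
  exists M, forall x, x < M ->
    y0 x < y x /\ y x - y0 x <= d * y0 x /\
    (1 - d) * sqrt (- x / 2) <= y x <= (1 + d) * sqrt (- x / 2).
Proof.
intros HHM Hb [_ Hy] Hd.
destruct (Hastings_McLeod_positive y0 HHM) as [_ Hpos].
destruct HHM as [_ [_ [Hm _]]].
set (d' := Rmin (1 / 2) (d / 2)).
assert (R1 : d' <= 1 / 2) by apply Rmin_l. assert (R2 : d' <= d / 2) by apply Rmin_r.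
assert (R0 : 0 < d') by (apply Rmin_pos; lra).
destruct (eq_one_plus_o_bound _ _ _ _ d' Hm R0) as [M1 HM1].
destruct (eq_one_plus_o_bound _ _ _ _ 1 Hy Rlt_0_1) as [M2 HM2].
(* Once [sqrt (- x / 2) > K], the difference [y - y0 <= 2 b] is less than half of
   [d' sqrt (- x / 2)]. *)
set (K := 2 * b / d' * 2).
assert (HK : 0 < K) by (unfold K; apply Rmult_lt_0_compat; [apply Rdiv_lt_0_compat|]; lra).
exists (Rmin (Rmin M1 M2) (Rmin (- 1) (- 2 * K ^ 2))). intros x Hx.
assert (Q1 := Rmin_l (Rmin M1 M2) (Rmin (- 1) (- 2 * K ^ 2))).
assert (Q2 := Rmin_r (Rmin M1 M2) (Rmin (- 1) (- 2 * K ^ 2))).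
assert (Q3 := Rmin_l M1 M2). assert (Q4 := Rmin_r M1 M2).
assert (Q5 := Rmin_l (- 1) (- 2 * K ^ 2)). assert (Q6 := Rmin_r (- 1) (- 2 * K ^ 2)).
destruct (HM1 x ltac:(lra)) as [r [Hr E]].
destruct (HM2 x ltac:(lra)) as [r' [Hr' E']]. cbv beta in E'.
assert (HS := sqrt_gt K x HK ltac:(lra)).
set (S := sqrt (- x / 2)) in *.
set (w := b / Rpower (- x) (1 / 4) * exp (- (2 * sqrt 2 / 3) * Rpower (- x) (3 / 2))) in *.
assert (Hw : 0 < w <= b).
{ assert (HP : 1 <= Rpower (- x) (1 / 4)).
  { apply Rle_trans with (Rpower (- x) 0); [rewrite Rpower_O; lra|apply Rle_Rpower; lra]. }
  assert (Hex : 0 < exp (- (2 * sqrt 2 / 3) * Rpower (- x) (3 / 2)) <= 1).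
  { split; [apply exp_pos|]. left. rewrite <- exp_0. apply exp_increasing.
    assert (0 < Rpower (- x) (3 / 2)) by apply exp_pos.
    assert (0 < sqrt 2) by (apply sqrt_lt_R0; lra). nra. }
  assert (HbP : 0 < b / Rpower (- x) (1 / 4) <= b).
  { split; [apply Rdiv_lt_0_compat; lra|].
    apply Rmult_le_reg_r with (Rpower (- x) (1 / 4)); [lra|].
    unfold Rdiv. rewrite Rmult_assoc, Rinv_l by lra. nra. }
  unfold w. split; [apply Rmult_lt_0_compat; lra|]. nra. }
assert (Hdiff : 0 < y x - y0 x <= 2 * b).
{ rewrite E'. split; [apply Rmult_lt_0_compat; lra|].
  rewrite (Rmult_comm 2). apply Rmult_le_compat; lra. }
assert (HKd : d' * K = 4 * b) by (unfold K; field; lra).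
assert (HdS : 4 * b < d' * S) by (rewrite <- HKd; apply Rmult_lt_compat_l; lra).
assert (HS0 : 0 < S) by lra.
assert (Hy0lo : (1 - d') * S <= y0 x) by (rewrite E; nra).
assert (Hy0hi : y0 x <= (1 + d') * S) by (rewrite E; nra).
assert (Hdd : d' * S <= d / 2 * S) by (apply Rmult_le_compat_r; lra).
split; [lra|]. split; [|split].
- assert (S / 2 <= y0 x) by nra. specialize (Hpos x). nra.
- lra.
- lra.
Qed.

Lemma PII_family_below_pole (y0 : R -> R) (b : R) (y : R -> R) (sigma : R) :
  is_Hastings_McLeod y0 -> 0 < b -> is_PII_family y0 b y -> is_first_pole y sigma ->
  forall x, x < sigma -> PII_ode_at y (Derive y) x /\ 0 < y x.
Proof.
intros HHM Hb Hfam [_ Hfirst].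
destruct (Hastings_McLeod_positive y0 HHM) as [Hode0 Hpos0].
assert (Hode : forall x, x < sigma -> PII_ode_at y (Derive y) x).
{ intros x Hx. apply PII_solution_ode; [apply Hfam|now apply Hfirst]. }
intros x Hx. split; [now apply Hode|].
apply Rlt_trans with (1 := Hpos0 x).
apply (PII_ordered y0 (Derive y0) y (Derive y) sigma Hode0 Hpos0 Hode); [| |exact Hx].
- apply is_lim_spec. intros [d Hd]. simpl.
  destruct (PII_family_growth y0 b y (d / 2) HHM Hb Hfam ltac:(lra)) as [M HM].
  exists M. intros z Hz. destruct (HM z Hz) as [H1 [H2 _]]. specialize (Hpos0 z).
  assert (E : y z / y0 z - 1 = (y z - y0 z) / y0 z) by (field; lra). rewrite E.
  assert (0 < (y z - y0 z) / y0 z) by (apply Rdiv_lt_0_compat; lra).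
  rewrite Rabs_pos_eq by lra.
  apply Rmult_lt_reg_r with (y0 z); [lra|]. unfold Rdiv.
  rewrite Rmult_assoc, Rinv_l by lra. nra.
- destruct (PII_family_growth y0 b y 1 HHM Hb Hfam ltac:(lra)) as [M HM].
  exists M. intros z Hz. now apply HM.
Qed.

(** * Cube roots and the limit *)

Lemma cube_root_pow3 (r : R) : 0 < r -> Rpower r (1 / 3) ^ 3 = r.
Proof.
intros Hr. rewrite <- Rpower_pow by apply exp_pos. rewrite Rpower_mult.
replace (1 / 3 * INR 3) with 1 by (simpl; field). now apply Rpower_1.
Qed.

Lemma cube_root_infty : is_lim_seq (fun n => Rpower (INR n) (1 / 3)) p_infty.
Proof.
apply is_lim_seq_spec. intros M.
set (K := Rmax M 1).
assert (HK1 : M <= K) by apply Rmax_l. assert (HK2 : 1 <= K) by apply Rmax_r.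
destruct (INR_unbounded (K ^ 3)) as [n0 Hn0].
exists n0. intros n Hn. apply le_INR in Hn.
assert (HK3 : 1 <= K ^ 3) by (apply pow_R1_Rle; lra).
apply Rle_lt_trans with (1 := HK1). apply Rnot_le_lt. intros Hle.
assert (H : Rpower (INR n) (1 / 3) ^ 3 <= K ^ 3).
{ apply pow_incr. split; [left; apply exp_pos|exact Hle]. }
rewrite cube_root_pow3 in H by lra. lra.
Qed.

Theorem theorem2p5 (eps sigma : R) (Heps : 0 < eps)
  (a : nat -> Z -> R)
  (Ha : forall n : nat, (1 <= n)%nat -> 0 < tpar sigma n ->
          is_bvp_solution eps (tpar sigma n) n (a n))
  (y0 : R -> R) (Hy0 : is_Hastings_McLeod y0)
  (b : R) (Hb : 0 < b)
  (y : R -> R) (Hy : is_PII_family y0 b y) (Hsigma : is_first_pole y sigma)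
  (x : R) (Hx : x < 0)
  (k : nat -> Z)
  (Hk : is_lim_seq (fun n => IZR (k n) / Rpower (INR n) (1 / 3)) x) :
  is_lim_seq
    (fun n => Rpower (INR n) (1 / 3) * a n (Z.of_nat n + k n)%Z)
    (Rpower 2 (1 / 3) * y (Rpower 2 (1 / 3) * x + sigma)).
Proof.
set (al := Rpower 2 (1 / 3)).
assert (Hal : 0 < al) by apply exp_pos.
assert (Hal3 : al ^ 3 = 2) by (apply cube_root_pow3; lra).
set (s := Rpower 2 (- (1 / 3)) * sigma).
assert (Hs : al * s = sigma).
{ unfold s, al. rewrite <- Rmult_assoc, <- Rpower_plus.
  replace (1 / 3 + - (1 / 3)) with 0 by ring. rewrite Rpower_O by lra. ring. }
assert (Hbelow := PII_family_below_pole y0 b y sigma Hy0 Hb Hy Hsigma).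
set (u := fun z => al * y (al * z + sigma)).
set (u1 := fun z => al ^ 2 * Derive y (al * z + sigma)).
assert (Hu : forall z, z < 0 -> is_derive u z (u1 z) /\
     is_derive u1 z (2 * (z + s) * u z + 2 * u z ^ 3) /\ 0 < u z).
{ intros z Hz. destruct (Hbelow (al * z + sigma)) as [[D1 D2] Hp]; [nra|].
  set (y1 := Derive y) in *. split; [|split].
  - unfold u, u1. auto_derive; [eexists; exact D1|].
    rewrite (is_derive_unique (fun t : R => y t) _ _ D1). ring.
  - unfold u1. auto_derive; [eexists; exact D2|].
    rewrite (is_derive_unique (fun t : R => y1 t) _ _ D2). unfold u.
    set (v := y (al * z + sigma)). rewrite <- Hs.
    replace (al * al * (1 * al * ((al * z + al * s) * v + 2 * v ^ 3)))
      with (al ^ 3 * (al * (z + s) * v + 2 * v ^ 3)) by ring.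
    replace (2 * (z + s) * (al * v) + 2 * (al * v) ^ 3)
      with (2 * (z + s) * (al * v) + 2 * (al ^ 3 * v ^ 3)) by ring.
    transitivity (al ^ 3 * (al * (z + s) * v + 2 * v ^ 3)); [simpl; ring|].
    rewrite Hal3. ring.
  - now apply Rmult_lt_0_compat. }
assert (Hnear : forall d, 0 < d -> exists eta, 0 < eta /\ forall X, 0 < X < eta ->
     1 - d <= X * u (- X) <= 1 + d).
{ intros d Hd.
  destruct (PII_pole_rate y (Derive y) sigma d Hd) as [r [Hr Hrate]].
  - intros z Hz. now apply Hbelow.
  (* A pole gives only [|y|] large; positivity to the left of [sigma] turns this into [y] tending to
     [+oo]. *)
  - intros K. destruct (pole_unbounded y sigma K (proj1 Hsigma)) as [r [Hr H]].
    exists r. split; [exact Hr|]. intros z Hz. specialize (H z ltac:(lra) ltac:(lra)).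
    rewrite Rabs_pos_eq in H; [exact H|]. left. apply Hbelow. lra.
  - exists (r / al). split; [now apply Rdiv_lt_0_compat|]. intros X HX.
    assert (HaX : al * X < r).
    { apply Rlt_le_trans with (al * (r / al)); [apply Rmult_lt_compat_l; lra|].
      right. field. lra. }
    assert (HaX0 : 0 < al * X) by (apply Rmult_lt_0_compat; lra).
    specialize (Hrate (al * - X + sigma) ltac:(lra)). unfold u.
    replace (X * (al * y (al * - X + sigma)))
      with ((sigma - (al * - X + sigma)) * y (al * - X + sigma)) by ring.
    exact Hrate. }
assert (Hfar : forall d, 0 < d -> exists L, forall X, L < X -> 0 < X ->
     (1 - d) * sqrt X <= u (- X) <= (1 + d) * sqrt X).
(* Two factors [1 + r] or [1 - r] are lost, one to the growth of [y] and one to replacing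
   [sqrt (X - c)] by [sqrt X]; the quarter makes their product fit into [1 + d] or [1 - d]. *)
{ intros d Hd. set (r := Rmin 1 d / 4).
  assert (R1 := Rmin_l 1 d). assert (R2 := Rmin_r 1 d).
  assert (R0 : 0 < Rmin 1 d) by (apply Rmin_pos; lra).
  assert (Hr : 0 < r) by (unfold r; lra).
  destruct (PII_family_growth y0 b y r Hy0 Hb Hy Hr) as [M HM].
  set (c := al ^ 2 * sigma / 2).
  assert (Hc1 := Rle_abs c). assert (Hc2 := Rle_abs (- c)). rewrite Rabs_Ropp in Hc2.
  exists (Rmax ((sigma - M) / al) (Rabs c / r)). intros X HX HX0.
  assert (Q1 := Rmax_l ((sigma - M) / al) (Rabs c / r)).
  assert (Q2 := Rmax_r ((sigma - M) / al) (Rabs c / r)).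
  assert (HzM : al * - X + sigma < M).
  { assert (al * ((sigma - M) / al) < al * X) by (apply Rmult_lt_compat_l; lra).
    replace (al * ((sigma - M) / al)) with (sigma - M) in H by (field; lra). lra. }
  assert (HrX : Rabs c < r * X).
  { replace (Rabs c) with (r * (Rabs c / r)) by (field; lra).
    apply Rmult_lt_compat_l; lra. }
  destruct (HM _ HzM) as [_ [_ [H1 H2]]].
  assert (HS : al * sqrt (- (al * - X + sigma) / 2) = sqrt (X - c)).
  { rewrite <- (sqrt_pow2 al) at 1 by lra. rewrite <- sqrt_mult_alt by nra. f_equal.
    transitivity (al ^ 3 * X / 2 - c); [unfold c; field|]. rewrite Hal3. field. }
  set (T := sqrt (- (al * - X + sigma) / 2)) in *.
  assert (HX1 : 0 < sqrt X) by now apply sqrt_lt_R0.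
  assert (HXX : sqrt X ^ 2 = X) by (apply pow2_sqrt; lra).
  assert (Hlo : (1 - r) * sqrt X <= al * T).
  { rewrite HS. rewrite <- (sqrt_pow2 ((1 - r) * sqrt X)) by (unfold r in *; nra).
    apply sqrt_le_1_alt. rewrite Rpow_mult_distr, HXX. unfold r in *. nra. }
  assert (Hhi : al * T <= (1 + r) * sqrt X).
  { rewrite HS. rewrite <- (sqrt_pow2 ((1 + r) * sqrt X)) by (unfold r in *; nra).
    apply sqrt_le_1_alt. rewrite Rpow_mult_distr, HXX. unfold r in *. nra. }
  unfold u. split.
  - apply Rle_trans with (al * ((1 - r) * T)); [|apply Rmult_le_compat_l; lra].
    replace (al * ((1 - r) * T)) with ((1 - r) * (al * T)) by ring.
    apply Rle_trans with ((1 - r) * ((1 - r) * sqrt X));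
      [|apply Rmult_le_compat_l; [unfold r; lra|exact Hlo]].
    rewrite <- Rmult_assoc. apply Rmult_le_compat_r; [lra|]. unfold r in *; nra.
  - apply Rle_trans with (al * ((1 + r) * T)); [apply Rmult_le_compat_l; lra|].
    replace (al * ((1 + r) * T)) with ((1 + r) * (al * T)) by ring.
    apply Rle_trans with ((1 + r) * ((1 + r) * sqrt X));
      [apply Rmult_le_compat_l; [unfold r; lra|exact Hhi]|].
    rewrite <- Rmult_assoc. apply Rmult_le_compat_r; [lra|]. unfold r in *; nra. }
change (al * y (al * x + sigma)) with (u x).
destruct (Hu x Hx) as [Dx [_ Hux]].
apply is_lim_seq_spec. intros [e He]. simpl.
(* Half of [e] goes to the sandwich, where the profile is at most [u x + 1] near [x], and half to
   the continuity of [u]. *)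
set (de := Rmin (1 / 2) (e / 2 / (u x + 1))).
assert (Hde1 : de <= 1 / 2) by apply Rmin_l.
assert (Hde2 : de * (u x + 1) <= e / 2).
{ apply Rle_trans with (e / 2 / (u x + 1) * (u x + 1)); [|right; field; lra].
  apply Rmult_le_compat_r; [lra|apply Rmin_r]. }
assert (Hde0 : 0 < de) by (apply Rmin_pos; [lra|]; apply Rdiv_lt_0_compat; lra).
(* This window contains [- k / N] as soon as [k / N] is within [- x / 2] of [x]. *)
destruct (scaled_sandwich u u1 eps s (- x / 2) (- x * 2) de Heps ltac:(lra) ltac:(lra)
  Hu Hnear Hfar) as [N0 [HN0 Hsand]].
assert (Hcont := is_derive_continuous _ _ _ Dx).
assert (Huk : is_lim_seq (fun n => u (IZR (k n) / Rpower (INR n) (1 / 3))) (u x)).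
{ apply (filterlim_comp _ _ _ (fun n => IZR (k n) / Rpower (INR n) (1 / 3)) u _ (locally x));
    [exact Hk|exact Hcont]. }
apply is_lim_seq_spec in Huk. apply is_lim_seq_spec in Hk.
assert (He' : 0 < Rmin 1 (e / 2)) by (apply Rmin_pos; lra).
assert (Hx' : 0 < - x / 2) by lra.
specialize (Huk (mkposreal _ He')). specialize (Hk (mkposreal _ Hx')). simpl in Huk, Hk.
assert (Hinf := proj2 (is_lim_seq_spec _ _) cube_root_infty (N0 + Rabs s + 1)).
assert (Hge1 : eventually (fun n => (1 <= n)%nat)) by (exists 1%nat; auto).
generalize (filter_and _ _ (filter_and _ _ Huk Hk) (filter_and _ _ Hinf Hge1)).
apply filter_imp. clear Huk Hk Hinf Hge1.
intros n [[Huk Hk] [HN Hn1]].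
set (N := Rpower (INR n) (1 / 3)) in *.
assert (Hs0 := Rabs_pos s). assert (Hs1 := Rle_abs s).
assert (HnR : 1 <= INR n) by (apply (le_INR 1 n), Hn1).
assert (HN3 : N ^ 3 = INR n) by (apply cube_root_pow3; lra).
assert (Ht : tpar sigma n = N ^ 3 - s * N) by (rewrite HN3; reflexivity).
assert (Htpos : 0 < tpar sigma n).
{ rewrite Ht. replace (N ^ 3 - s * N) with (N * (N * N - s)) by ring.
  apply Rmult_lt_0_compat; nra. }
specialize (Ha n Hn1 Htpos). rewrite Ht in Ha.
assert (HXk : (INR n - IZR (Z.of_nat n + k n)) / N = - (IZR (k n) / N)).
{ rewrite plus_IZR, <- INR_IZR_INZ. field. lra. }
apply Rabs_def2 in Hk. apply Rabs_def2 in Huk.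
assert (Hm1 := Rmin_l 1 (e / 2)). assert (Hm2 := Rmin_r 1 (e / 2)).
specialize (Hsand n N (a n) (Z.of_nat n + k n)%Z ltac:(lra) HN3 Ha).
rewrite HXk, Ropp_involutive in Hsand. specialize (Hsand ltac:(lra)).
set (un := u (IZR (k n) / N)) in *.
assert (de * un <= de * (u x + 1)) by (apply Rmult_le_compat_l; lra).
apply Rabs_def1; lra.
Qed.
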